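(* Assume the following statement (P) holds: for every $\varepsilon>0$ there is a constant $C_\varepsilon$ such that for every $N$ there is a finite set $\{\phi_j\}$ of 2-step nilsequences, each of complexity at most $C_\varepsilon$, such that for every $A\subseteq\{1,\dots,N\}$ there are complex coefficients $c_{A,j}$ with $\sum_j|c_{A,j}|\leq1$ and a function $e_A$ with $|e_A(d)|\leq\varepsilon$ for $d=1,\dots,N$, satisfying $F_A(d)=\sum_jc_{A,j}\phi_j(d)+e_A(d)$ for $d=1,\dots,N$, where $F_A(d)=\frac1N\sum_{x=1}^N1_A(x)1_A(x+d)1_A(x+2d)$. Let $\mu:\mathbb N\to[0,1]$ satisfy $d\,\mu(d)\to\infty$ as $d\to\infty$, and let $S\subseteq\{1,\dots,N\}$ be random, each $d\in\{1,\dots,N\}$ lying in $S$ independently with probability $\mu(d)$. Then for every $\delta>0$, the probability that every $A\subseteq\{1,\dots,N\}$ with $|A|\geq\delta N$ contains a 3-term arithmetic progression $x,x+d,x+2d\in A$ with $d\in S$ is $1-o(N^{-100})$ as $N\to\infty$.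
   Context: An $s$-step nilsequence is a function $\phi(n)=\psi(p(n)\Gamma)$ built from: a connected, simply-connected nilpotent Lie group $G$ with Lie algebra $\mathfrak g$; a lattice $\Gamma\le G$; a filtration $G=G_0=G_1\supseteq\cdots\supseteq G_{s+1}=\{e\}$ with $[G_i,G_j]\subseteq G_{i+j}$ and $\Gamma\cap G_i$ a lattice in $G_i$; a polynomial sequence $p:\mathbb Z\to G$ with respect to this filtration (all $i$-fold iterated derivatives $\partial_{h_1}\cdots\partial_{h_i}p$, $\partial_hp(n)=p(n+h)p(n)^{-1}$, take values in $G_i$); a Mal'cev basis $\mathscr B$ of $\mathfrak g$ adapted to the filtration with rational structure constants; and $\psi:G/\Gamma\to\mathbb C$ Lipschitz with respect to the right-invariant metric $d_{\mathscr B}$ on $G/\Gamma$ induced by $\mathscr B$. Its complexity is at most $C$ if $\dim G$, the heights of the structure constants with respect to $\mathscr B$, the heights of the $\mathscr B$-coordinates of $\log g$ for $g$ in some generating set of $\Gamma$, the Lipschitz constant of $\psi$, and $\|\psi\|_\infty$ are all at most $C$. Here $1_A(y)=0$ for $y\notin A$. *)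

(* Defs.v *)
From HB Require Import structures.
From mathcomp Require Import all_boot all_order all_algebra.
From mathcomp Require Import all_classical all_reals all_analysis.
From mathcomp Require Import complex.
Set Implicit Arguments.
Unset Strict Implicit.
Unset Printing Implicit Defensive.
Import Order.TTheory GRing.Theory Num.Theory.
Import numFieldNormedType.Exports.
Local Open Scope classical_set_scope.
Local Open Scope ring_scope.

(* On 'rV[R]_m, having continuous iterated directional derivatives of all orders
   up to k is the same as being C^k. *)
Fixpoint Ck (R : realType) (V W : normedModType R) (k : nat) (f : V -> W)
    : Prop :=
  continuous f /\
  (if k is k'.+1 then
     forall v, (forall x, derivable f x v) /\ Ck k' (fun x => 'D_v f x)
   else True).

Definition smooth (R : realType) (V W : normedModType R) (f : V -> W) : Prop :=
  forall k, Ck k f.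

(* A Lie group whose exponential map is a global diffeomorphism from its Lie
   algebra, given with log as global chart.  Every connected simply connected
   nilpotent Lie group is of this form; conversely such a group is diffeomorphic
   to R^m, hence connected and simply connected, and nilpotency is part of
   [is_filtration] below.
   The Lie algebra is 'rV[R]_m as a vector space, in arbitrary linear
   coordinates.  Inversion is X |-> - X in the chart, so only multiplication is
   required to be smooth.  [lie_add] and [lie_bracket] say that the vector space
   structure and the bracket are those of the Lie algebra of the group;
   [~ x, y] is x^-1 y^-1 x y, which has the same leading term as
   x y x^-1 y^-1. *)
Record lieGroup (R : realType) := LieGroup {
  lie_sort :> groupType;
  lie_dim : nat;
  lie_exp : 'rV[R]_lie_dim -> lie_sort;
  lie_log : lie_sort -> 'rV[R]_lie_dim;
  lie_br : 'rV[R]_lie_dim -> 'rV[R]_lie_dim -> 'rV[R]_lie_dim;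
  lie_expK : cancel lie_exp lie_log;
  lie_logK : cancel lie_log lie_exp;
  lie_smooth : smooth (fun z : 'rV[R]_lie_dim * 'rV[R]_lie_dim =>
    lie_log (lie_exp z.1 * lie_exp z.2)%g);
  lie_one_param : forall (s t : R) (X : 'rV[R]_lie_dim),
    lie_exp ((s + t) *: X) = (lie_exp (s *: X) * lie_exp (t *: X))%g;
  lie_add : forall X Y : 'rV[R]_lie_dim,
    t^-1 *: lie_log (lie_exp (t *: X) * lie_exp (t *: Y))%g @[t --> 0^']
      --> X + Y;
  lie_bracket : forall X Y : 'rV[R]_lie_dim,
    (t ^+ 2)^-1 *: lie_log [~ lie_exp (t *: X), lie_exp (t *: Y)]%g @[t --> 0^']
      --> lie_br X Y
}.

Definition subgroup (G : groupType) (H : set G) : Prop :=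
  H 1%g /\ forall x y, H x -> H y -> H (x / y)%g.

Definition lcoset (G : groupType) (Gam : set G) (x : G) : set G :=
  [set (x * g)%g | g in Gam].

Definition generates (G : groupType) (S Gam : set G) : Prop :=
  S `<=` Gam /\ forall H : set G, subgroup H -> S `<=` H -> Gam `<=` H.

(* The topology on G is that of the chart log. *)
Definition is_discrete (R : realType) (G : lieGroup R) (L : set G) : Prop :=
  exists2 U : set 'rV[R]_(lie_dim G),
    nbhs (0 : 'rV[R]_(lie_dim G)) U & forall g, L g -> U (lie_log g) -> g = 1%g.

Definition is_cocompact (R : realType) (G : lieGroup R) (L H : set G) : Prop :=
  exists K : set 'rV[R]_(lie_dim G),
    [/\ compact K, (@lie_exp R G) @` K `<=` H &
        forall h, H h -> exists k g, [/\ K k, L g & h = (lie_exp k * g)%g]].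

(* For nilpotent Lie groups, finite covolume amounts to cocompactness. *)
Definition is_lattice (R : realType) (G : lieGroup R) (L H : set G) : Prop :=
  [/\ subgroup L, L `<=` H, is_discrete L & is_cocompact L H].

Definition is_filtration (G : groupType) (s : nat) (F : nat -> set G) : Prop :=
  [/\ F 0%N = setT /\ F 1%N = setT,
      forall i, subgroup (F i),
      forall i, F i.+1 `<=` F i,
      forall i, (s < i)%N -> F i = [set 1%g] &
      forall i j x y, F i x -> F j y -> F (i + j)%N [~ x, y]%g].

Definition gderiv (G : groupType) (h : int) (p : int -> G) : int -> G :=
  fun n => (p (n + h) / p n)%g.

Definition is_polynomial (G : groupType) (F : nat -> set G) (p : int -> G)
    : Prop :=
  forall (hs : seq int) (n : int),
    F (size hs) (foldr (@gderiv G) p hs n).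

Section Malcev.
Variables (R : realType) (G : lieGroup R) (B : 'M[R]_(lie_dim G)).
Local Notation m := (lie_dim G).

(* The rows of B are the basis vectors X_0, ..., X_{m-1}. *)
Definition bcoord (X : 'rV[R]_m) : 'rV[R]_m := X *m invmx B.

(* The span of X_j, ..., X_{m-1}. *)
Definition tail_span (j : nat) : set 'rV[R]_m :=
  [set X | forall k : 'I_m, (k < j)%N -> bcoord X 0 k = 0].

Definition exp_prod (t : 'rV[R]_m) : G :=
  (\prod_(i < m) lie_exp (t 0 i *: row i B)%R)%g.

Definition struct_const (i j k : 'I_m) : R :=
  bcoord (lie_br (row i B) (row j B)) 0 k.

Definition rational (x : R) : Prop := exists q : rat, x = ratr q.

Definition is_malcev_basis (F : nat -> set G) : Prop :=
  [/\ B \in unitmx,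
      forall (j : nat) X Y, tail_span j Y -> tail_span j (lie_br X Y),
      forall i, exists2 j, (j <= m)%N & F i = (@lie_exp R G) @` tail_span j,
      bijective exp_prod &
      forall i j k, rational (struct_const i j k)].

Definition malcev_coord (x : G) : 'rV[R]_m := xget 0 [set t | exp_prod t = x].

(* The metric d_B is that of Green and Tao: the largest metric on G such that
   d(x,y) is at most the sup norm of the Mal'cev coordinates of the second kind
   of x y^-1.  The norm on 'rV[R]_m is the sup norm. *)
Definition step_cost (x y : G) : R :=
  Num.min `|malcev_coord (x / y)%g| `|malcev_coord (y / x)%g|.

Fixpoint chain_cost (x : G) (s : seq G) : R :=
  if s is y :: s' then step_cost x y + chain_cost y s' else 0.

Definition malcev_dist (x y : G) : R :=
  inf [set chain_cost x s | s in [set s : seq G | last x s = y]].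

(* The distance on G / Gam, for a and b left cosets of Gam. *)
Definition coset_dist (a b : set G) : R :=
  inf [set malcev_dist x y | x in a & y in b].

End Malcev.

Definition height (q : rat) : nat := maxn `|numq q| `|denq q|.

Definition rational_height_le (R : realType) (C x : R) : Prop :=
  exists2 q : rat, x = ratr q & (height q)%:R <= C.

Definition lipschitz_on_cosets (R : realType) (G : lieGroup R)
    (B : 'M[R]_(lie_dim G)) (Gam : set G) (psi : set G -> R[i]) (K : R)
    : Prop :=
  forall x y : G,
    ComplexField.Normc.normc (psi (lcoset Gam x) - psi (lcoset Gam y))
      <= K * coset_dist B (lcoset Gam x) (lcoset Gam y).

(* Only the values of [nil_psi] on left cosets of [nil_Gam] matter. *)
Record nilsequence (R : realType) (s : nat) := Nilsequence {
  nil_G : lieGroup R;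
  nil_F : nat -> set nil_G;
  nil_Gam : set nil_G;
  nil_p : int -> nil_G;
  nil_B : 'M[R]_(lie_dim nil_G);
  nil_psi : set nil_G -> R[i];
  nil_filtration : is_filtration s nil_F;
  nil_lattice : forall i, is_lattice (nil_Gam `&` nil_F i) (nil_F i);
  nil_polynomial : is_polynomial nil_F nil_p;
  nil_malcev : is_malcev_basis nil_B nil_F;
  nil_lipschitz : exists K : R, lipschitz_on_cosets nil_B nil_Gam nil_psi K
}.

Arguments nil_G {R s} _.
Arguments nil_F {R s} _ _ _.
Arguments nil_Gam {R s} _ _.
Arguments nil_p {R s} _ _.
Arguments nil_B {R s} _.
Arguments nil_psi {R s} _ _.

Definition nil_val (R : realType) (s : nat) (phi : nilsequence R s) (n : int)
    : R[i] :=
  nil_psi phi (lcoset (nil_Gam phi) (nil_p phi n)).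

Definition complexity_le (R : realType) (s : nat) (phi : nilsequence R s)
    (C : R) : Prop :=
  let G := nil_G phi in let B := nil_B phi in
  [/\ (lie_dim G)%:R <= C,
      forall i j k, rational_height_le C (struct_const B i j k),
      exists2 S : set G, generates S (nil_Gam phi) &
        forall g k, S g -> rational_height_le C (bcoord B (lie_log g) 0 k),
      lipschitz_on_cosets B (nil_Gam phi) (nil_psi phi) C &
      forall x : G,
        ComplexField.Normc.normc (nil_psi phi (lcoset (nil_Gam phi) x)) <= C].

(* A subset of {1, ..., N} is encoded as A : {set 'I_N}, where i : 'I_N stands
   for the integer i + 1. *)
Definition elt (N : nat) (A : {set 'I_N}) (y : nat) : bool :=
  [exists a in A, a.+1 == y].

Definition ap_count (R : realType) (N : nat) (A : {set 'I_N}) (d : nat) : R :=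
  N%:R^-1 * \sum_(1 <= x < N.+1)
    (elt A x)%:R * (elt A (x + d))%:R * (elt A (x + 2 * d))%:R.

Definition nilsequence_approximation (R : realType) : Prop :=
  forall eps : R, 0 < eps -> exists C : R,
  forall N : nat, (0 < N)%N ->
  exists (k : nat) (phi : 'I_k -> nilsequence R 2),
    (forall j, complexity_le (phi j) C) /\
    forall A : {set 'I_N},
    exists (c : 'I_k -> R[i]) (e : nat -> R[i]),
      [/\ \sum_j ComplexField.Normc.normc (c j) <= 1,
          forall d, (1 <= d <= N)%N -> ComplexField.Normc.normc (e d) <= eps &
          forall d : nat, (1 <= d <= N)%N ->
            (ap_count R A d)%:C%C = \sum_j c j * nil_val (phi j) d%:Z + e d].

(* The law of a random subset of {1, ..., N} containing each d independently
   with probability mu d. *)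
Definition random_subset_prob (R : realType) (mu : nat -> R) (N : nat)
    (E : set {set 'I_N}) : R :=
  \sum_(S : {set 'I_N} | `[< E S >])
    \prod_(i < N) (if i \in S then mu i.+1 else 1 - mu i.+1).

Definition dense_sets_have_AP (R : realType) (delta : R) (N : nat)
    : set {set 'I_N} :=
  [set S | forall A : {set 'I_N}, delta * N%:R <= #|A|%:R ->
    exists x d : nat, [/\ elt S d, elt A x, elt A (x + d) & elt A (x + 2 * d)]].

(* Main.v *)
(** By hypothesis the counting functions [F_A] lie within [eps] of the
    absolutely convex hull of the 2-step nilsequences of complexity at most [C].
    Restricted to {1, ..., N}, these nilsequences have [eps]-covering number
    polynomial in [N].  Indeed, in logarithmic coordinates for the Mal'cev basis
    the group law is [x + y + [x, y] / 2] (Baker-Campbell-Hausdorff), and bounded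
    heights leave finitely many choices for the bracket and for the generators of
    the lattice; so fundamental domains are bounded in terms of [C] alone, and
    modulo the lattice a polynomial sequence is [a b^n v^(n choose 2)] with [v]
    central and [a], [b], [v] bounded, which may be rounded to a grid of mesh
    about [N^-4].

    Give each [d] in [S] a weight in [0, 1] that turns the density [mu d] into
    [kappa / d] for a large constant [kappa].  As [exp (sum 1/d)] is at least a
    constant times [N], Chernoff's bound makes the failure probability for one
    function at most a constant times [N^-r], where [r] grows with [kappa]; so a
    union bound controls the deviation of all the functions of the cover, hence of
    every [F_A].  Finally Roth's theorem on dilated progressions gives
    [sum F_A(d) / d >= c sum 1 / d], so the weighted sum of [F_A] over [S] is
    positive.  Roth's theorem itself is proved by Szemeredi's cube argument. *)

Require Import Defs.
From mathcomp Require Import all_boot all_order all_algebra.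
From mathcomp Require Import all_classical all_reals all_analysis.
From mathcomp Require Import complex zify ring lra.
Import Order.TTheory GRing.Theory Num.Theory.
Import numFieldNormedType.Exports.
Local Open Scope classical_set_scope.
Local Open Scope ring_scope.
Set Implicit Arguments.
Unset Strict Implicit.
Unset Printing Implicit Defensive.

(** * Roth's theorem *)

(** The hypothesis [d mu(d) -> oo] has no rate, so all estimates compete through exponents of [N].
    The cover has at most [A * N ^ D] members with [D] fixed by the complexity, one deviation costs
    about [N ^- r] with [r] proportional to [kappa], and [kappa] may be taken as large as wished
    because [d mu(d)] exceeds any constant from some [d0] on; smaller differences get weight 0.
    After this thinning everything is measured against the harmonic mass [hsum], about [log N],
    whatever [mu] is. That mass is spread evenly over all scales, so Roth's theorem is needed for
    differences of every size, not only for those comparable to [N].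

    Two ingredients of a nilsequence are not described by boundedly many numbers. The Lipschitz
    function becomes a table on a grid independent of [N], so that only the orbit parameters
    contribute powers of [N]. The size of a fundamental domain comes from cocompactness, a bare
    existence statement; it becomes uniform because bounded heights leave finitely many lattices in
    coordinates. *)

Definition cnt (A : nat -> bool) (n : nat) : nat := (\sum_(i < n) A i)%N.

Lemma cntD (A : nat -> bool) s n : cnt A (s + n) = (cnt A s + cnt (fun i => A (s + i)%N) n)%N.
Proof. by rewrite /cnt big_split_ord. Qed.

Lemma cnt_le A n : (cnt A n <= n)%N.
Proof.
rewrite /cnt -[leqRHS]card_ord -sum1_card; apply: leq_sum => i _.
exact: leq_b1.
Qed.

Lemma leq_cnt (A B : nat -> bool) n : (forall i, (i < n)%N -> A i -> B i) -> (cnt A n <= cnt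
    B n)%N.
Proof. by move=> h; apply: leq_sum => i _; case: (A i) (h i (ltn_ord i)) => // ->. Qed.

Lemma leq_cnt2 A m n : (m <= n)%N -> (cnt A m <= cnt A n)%N.
Proof. by move=> /subnK <-; rewrite addnC cntD leq_addr. Qed.

Lemma cnt_shift_ge (A : nat -> bool) s n : (cnt A n <= cnt (fun i => A (i + s)) n + s)%N.
Proof.
apply: (leq_trans (leq_cnt2 A (leq_addl s n))).
rewrite cntD addnC leq_add ?cnt_le //.
by apply: leq_cnt => i _; rewrite addnC.
Qed.

Lemma cnt_shift_le (A : nat -> bool) s n : (cnt (fun i => A (i + s)) n <= cnt A n + s)%N.
Proof.
have -> : cnt (fun i => A (i + s)%N) n = cnt (fun i => A (s + i)%N) n.
  by apply: eq_bigr => i _; rewrite addnC.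
apply: (@leq_trans (cnt A (s + n))); first by rewrite cntD leq_addl.
by rewrite addnC cntD leq_add2l cnt_le.
Qed.

(** Sum over the [t] shifts of [A] by [i * D]: each loses at most [i * D <= t * D] of the points
    below [n]. *)
Lemma cnt_window (A : nat -> bool) t D n :
  (t * cnt A n <= \sum_(y < n) cnt (fun i => A (y + i * D)) t + t * (t * D))%N.
Proof.
rewrite exchange_big /=.
rewrite -[X in (X * cnt A n)%N]card_ord -[X in (_ + X * _)%N]card_ord -!sum_nat_const
    -big_split /=.
apply: leq_sum => i _; apply: (leq_trans (cnt_shift_ge A (i * D) n)).
by rewrite leq_add2l leq_mul2r ltnW ?orbT.
Qed.

Definition ap3_free (A : nat -> bool) : Prop :=
  forall x d, (0 < d)%N -> A x -> A (x + d)%N -> A (x + 2 * d)%N -> False.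

Lemma ap3_free_sub (A : nat -> bool) a D : (0 < D)%N -> ap3_free A -> ap3_free (fun i => A (a
    + i * D)%N).
Proof.
move=> D0 hA x d d0 h1 h2 h3; apply: (hA (a + x * D)%N (d * D)%N); first by rewrite muln_gt0 d0.
- exact: h1.
- by move: h2; rewrite mulnDl addnA.
- by move: h3; rewrite mulnDl addnA mulnA.
Qed.

(** * Hilbert cubes in dense sets *)

Fixpoint hcube (a : nat) (ds : seq nat) : seq nat :=
  if ds is d :: ds' then hcube a ds' ++ [seq (m + d)%N | m <- hcube a ds'] else [:: a].

(** Sort the ordered pairs of elements of [B] below [q] by their difference; the factor 2 accounts
    for its sign, and the diagonal [d = 0] is kept. *)
Lemma cnt_sqr (B : nat -> bool) q :
  (cnt B q ^ 2 <= 2 * \sum_(d < q) cnt (fun i => [&& B i, B (i + d) & i + d < q]) q)%N.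
Proof.
have tri (i : 'I_q) : (\sum_(j < q) (i <= j) * B j <= \sum_(d < q) (B (i + d) && (i + d <
    q)))%N.
  pose P j := (i <= j)%N && B j && (j < q)%N.
  have -> : (\sum_(j < q) (i <= j) * B j = cnt P q)%N.
    by apply: eq_bigr => j _; rewrite /P ltn_ord andbT mulnb.
  apply: (leq_trans (@leq_cnt2 P q (i + q) (leq_addl i q))).
  rewrite cntD.
  have -> : cnt P i = 0%N.
    by apply: big1 => j _; rewrite /P leqNgt ltn_ord.
  apply: (@leq_cnt (fun j => P (i + j)%N) (fun d => B (i + d)%N && (i + d < q)%N)) => j _.
  by rewrite /P => /andP[/andP[_ -> ->]].
have h (P : 'I_q -> 'I_q -> bool) (hP : forall i j, P i j || P j i) :
  (cnt B q ^ 2 <= 2 * \sum_(i < q) B i * \sum_(j < q) P i j * B j)%N.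
  have -> : (cnt B q ^ 2 = \sum_(i < q) \sum_(j < q) B i * B j)%N.
    by rewrite expnS expn1 /cnt big_distrl; apply: eq_bigr => i _; rewrite big_distrr.
  rewrite mul2n -addnn -{2}(eq_bigr _ (fun i _ => esym (big_distrr _ _ _))) /=.
  rewrite [X in (_ <= _ + X)%N]exchange_big /=.
  under [X in (_ <= X + _)%N]eq_bigr do rewrite big_distrr.
  rewrite -big_split; apply: leq_sum => i _; rewrite -big_split; apply: leq_sum => j _ /=.
  by move: (hP i j); case: (P i j); case: (P j i); case: (B i); case: (B j).
apply: (leq_trans (h (fun i j => (i <= j)%N) (fun i j => leq_total i j))).
rewrite leq_mul2l /= exchange_big /=. apply: leq_sum => i _.
apply: (leq_trans (leq_mul (leqnn _) (tri i))).
by rewrite big_distrr; apply: leq_sum => d _ /=; case: (B i); rewrite ?mul1n.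
Qed.

Section Roth.
Variable R : realType.

(** Induction on the dimension: by [cnt_sqr] some positive [d] is such that the [i] with [i] and
    [i + d] in [A] still have density [b ^+ 2 / 4]. A cube among these [i], together with its
    translate by [d], lies in [A]. *)
Lemma hilbert_cube (k : nat) : forall b : R, 0 < b ->
  exists q0 : nat, forall q, (q0 <= q)%N -> forall A, b * q%:R <= (cnt A q)%:R ->
  exists a ds, [/\ size ds = k, all (fun d => 0 < d <= q)%N ds &
    all (fun m => A m && (m < q)%N) (hcube a ds)].
Proof.
elim: k => [|k IH] b b0.
  exists 1%N => q q1 A hA.
  have /existsP [i hi] : [exists i : 'I_q, A i].
    apply: contraT; rewrite negb_exists => /forallP h.
    suff h0 : cnt A q = 0%N.
      by move: hA; rewrite h0 leNgt mulr_gt0 // ltr0n.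
    by apply: big1 => i _; rewrite (negbTE (h i)).
  by exists i, [::]; split => //=; rewrite hi ltn_ord.
have b4 : 0 < b ^+ 2 / 4 by rewrite divr_gt0 // exprn_gt0.
have [q0 hq0] := IH _ b4.
(* Beyond this threshold the diagonal contributes less than half of [(b * q) ^+ 2]. *)
pose q1 := Num.bound (4 / b ^+ 2).
exists (maxn q0 q1.+1) => q; rewrite geq_max => /andP[qq0 qq1] A hA.
have q0R : 0 < q%:R :> R by rewrite ltr0n (leq_trans _ qq1).
have [d [d0 hd]] : exists d, (0 < d)%N /\
   b ^+ 2 / 4 * q%:R <= (cnt (fun i => [&& A i, A (i + d) & i + d < q]%N) q)%:R.
  apply: contrapT => hn.
  have hs := cnt_sqr A q.
  have : (b * q%:R) ^+ 2 <= 2 * (q%:R + q%:R * (b ^+ 2 / 4 * q%:R)).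
    apply: (@le_trans _ _ ((cnt A q ^ 2)%N%:R)).
      by rewrite natrX lerXn2r ?nnegrE // mulr_ge0 // ltW.
    apply: (le_trans (y := (2 * (q + \sum_(d < q | (0 < d)%N) cnt (fun i => [&& A i, A (i +
        d) & i + d < q]) q))%N%:R)).
      rewrite ler_nat (leq_trans hs) // leq_mul2l /= (bigID (fun d : 'I_q => 0 < d)%N) /=
          addnC leq_add2r.
      apply: (@leq_trans (\sum_(i < q | ~~ (0 < i)%N) q)%N).
        by apply: leq_sum => i _; exact: cnt_le.
      rewrite sum_nat_const -[leqRHS]mul1n leq_mul2r; apply/orP; right.
      apply/card_le1_eqP => x y; rewrite /in_mem /= -!eqn0Ngt => /eqP hx /eqP hy.
      by apply: val_inj; rewrite /= hx hy.
    rewrite natrM natrD natr_sum ler_pM2l // lerD2l.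
    rewrite -[X in _ <= X%:R * _]card_ord mulr_natl -sumr_const.
    apply: (@le_trans _ _ (\sum_(d < q | (0 < d)%N) b ^+ 2 / 4 * q%:R)).
      apply: ler_sum => d d0; rewrite leNgt; apply/negP => /ltW h.
      by apply: hn; exists d.
    rewrite big_mkcond; apply: ler_sum => i _; case: ifP => // _.
    by rewrite mulr_ge0 // ltW.
  have : 4 / b ^+ 2 < q%:R.
    apply: lt_trans (archi_boundP _) _; first by rewrite divr_ge0 // exprn_ge0 // ltW.
    by rewrite ltr_nat.
  rewrite ltr_pdivrMr ?exprn_gt0 // => h1.
  have h2 : 4 * q%:R < q%:R * b ^+ 2 * q%:R by rewrite ltr_pM2r.
  by rewrite exprMn; nra.
have [a [ds [sds ads hc]]] := hq0 q qq0 _ hd.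
exists a, (d :: ds); split => /=; first by rewrite sds.
- rewrite ads d0 andbT /=.
  (* Any point [i] of the cube witnesses [d <= q] through [i + d < q]; one exists because a cube is
     never empty. *)
  have : hcube a ds != [::] by clear; elim: ds => //= d ds; case: (hcube a ds).
  case: (hcube a ds) hc => //= m s /andP[/andP[/and3P[_ _ h] _] _] _.
  by apply: ltnW; apply: leq_ltn_trans h; rewrite leq_addl.
- rewrite all_cat all_map; apply/andP; split.
    by apply: sub_all hc => m /andP[/and3P[-> _ _] ->].
  by apply: sub_all hc => m /= /andP[/and3P[_ -> ->] _].
Qed.


(* The reflections [2 m - x] of [A] intersected with [0, l) through the points
   [m] of a cube. *)
Fixpoint cube_refl (A : nat -> bool) (l a : nat) (ds : seq nat) : nat -> bool :=
  if ds is d :: ds' then fun y =>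
    cube_refl A l a ds' y || ((2 * d <= y)%N && cube_refl A l a ds' (y - 2 * d)%N)
  else fun y => [&& y <= 2 * a, 2 * a - y < l & A (2 * a - y)]%N.

Lemma cube_reflP A l a ds y : cube_refl A l a ds y ->
  exists m x, [/\ m \in hcube a ds, (x < l)%N, A x & (x + y = 2 * m)%N].
Proof.
elim: ds y => [|d ds IH] y /=.
  case/and3P=> h1 h2 h3; exists a, (2 * a - y)%N; rewrite inE eqxx; split => //.
  by rewrite subnK.
case/orP => [/IH[m [x [h1 h2 h3 h4]]]|/andP[hd /IH[m [x [h1 h2 h3 h4]]]]].
  by exists m, x; rewrite mem_cat h1.
exists (m + d)%N, x; split => //; last by lia.
by rewrite mem_cat (map_f (fun m => m + d)%N h1) orbT.
Qed.

(** Reflection is injective, and the range of [a] keeps [2 * a - x], for [x < l], inside [0, 4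
    l). *)
Lemma cube_refl0 A l a : (l <= a)%N -> (a < 2 * l)%N -> 
  (cnt A l <= cnt (cube_refl A l a [::]) (4 * l))%N.
Proof.
move=> la al.
have -> : cnt A l = cnt (fun i => cube_refl A l a [::] (2 * a - l + 1 + i))%N l.
  rewrite /cnt (reindex_inj rev_ord_inj) /=; apply: eq_bigr => i _.
  have il := ltn_ord i.
  have -> : (2 * a - (2 * a - l + 1 + i) = l - i.+1)%N by lia.
  have -> : (2 * a - l + 1 + i <= 2 * a)%N by lia.
  by have -> : (l - i.+1 < l)%N by lia.
have h : (2 * a - l + 1 + l <= 4 * l)%N by lia.
by apply: leq_trans (leq_cnt2 _ h); rewrite cntD leq_addl.
Qed.

(** Since [x < l <= m], the points [x], [m] and [y = 2 * m - x] form a progression with positive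
    difference. *)
Lemma cube_refl_free A l a ds y : ap3_free A -> all (fun m => A m && (l <= m)%N) (hcube a ds) ->
  cube_refl A l a ds y -> A y -> False.
Proof.
move=> hA hc /cube_reflP[m [x [hm xl Ax e]]] Ay.
have /allP/(_ _ hm)/andP[Am lm] := hc.
apply: (hA x (m - x)%N) => //; first by lia.
- by have -> : (x + (m - x) = m)%N by lia.
- by have -> : (x + 2 * (m - x) = y)%N by lia.
Qed.

(** If [y] is in the smaller set and [y + 2 * d] is not, then [y + 2 * d] is a new point of the
    larger set; the term [2 * d] pays for those beyond [n]. *)
Lemma cube_refl_exit A l a d ds n :
  (cnt (fun y => cube_refl A l a ds y && ~~ cube_refl A l a ds (y + 2 * d)) n
    + cnt (cube_refl A l a ds) n <= cnt (cube_refl A l a (d :: ds)) n + 2 * d)%N.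
Proof.
set N := cube_refl A l a ds; set N' := cube_refl A l a (d :: ds).
have -> : cnt N' n = (cnt (fun y => N' y && ~~ N y) n + cnt N n)%N.
  rewrite /cnt -big_split; apply: eq_bigr => i _ /=.
  by rewrite /N' /= -/N; case: (N i); case: (_ && _).
rewrite addnAC leq_add2r.
apply: leq_trans (cnt_shift_le _ _ _); apply: leq_cnt => y _ /andP[h1 h2].
by rewrite /N' /= -/N h2 leq_addl addnK h1 orbT.
Qed.

(** Add the generators one at a time: the sets grow inside [0, n), and [size ds] steps that each add
    more than [n / size ds] points would overfill it. By [cube_refl_exit], a step of small growth
    yields a set nearly invariant under [2 * d]. *)
Lemma cube_refl_pigeonhole A l a ds n : (0 < size ds)%N ->
  exists d ds', [/\ d \in ds, {subset hcube a ds' <= hcube a ds} &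
   (size ds * cnt (cube_refl A l a (d :: ds')) n
       <= size ds * cnt (cube_refl A l a ds') n + n)%N] /\
   (cnt (cube_refl A l a [::]) n <= cnt (cube_refl A l a ds') n)%N.
Proof.
move=> s0; set k := size ds.
have key : forall ds0, {subset ds0 <= ds} -> {subset hcube a ds0 <= hcube a ds} ->
  (cnt (cube_refl A l a [::]) n <= cnt (cube_refl A l a ds0) n)%N /\
  ((exists d ds', [/\ d \in ds, {subset hcube a ds' <= hcube a ds} &
   (k * cnt (cube_refl A l a (d :: ds')) n <= k * cnt (cube_refl A l a ds') n + n)%N] /\
   (cnt (cube_refl A l a [::]) n <= cnt (cube_refl A l a ds') n)%N)
  \/ (size ds0 * n.+1 <= k * cnt (cube_refl A l a ds0) n)%N).
  elim=> [|d ds0 IH] h1 h2; first by split=> //; right.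
  have [||hm [hl|hr]] := IH.
  - by move=> x hx; apply: h1; rewrite inE hx orbT.
  - by move=> x hx; apply: h2; rewrite /= mem_cat hx.
  - split; last by left.
    by apply: (leq_trans hm); apply: leq_cnt => i _ /= ->.
  - split.
      by apply: (leq_trans hm); apply: leq_cnt => i _ /= ->.
    case: (leqP (k * cnt (cube_refl A l a (d :: ds0)) n) (k * cnt (cube_refl A l a ds0) n +
        n)) => h.
      left; exists d, ds0; split => //; split => //; first by apply: h1; rewrite inE eqxx.
      by move=> x hx; apply: h2; rewrite /= mem_cat hx.
    right; rewrite /= mulSn; move: h hr.
    set u := (k * _)%N; set v := (k * _)%N; set w := (_ * n.+1)%N; lia.
have [//|//|_ [//|h]] := key ds.
have := leq_trans h (leq_mul (leqnn k) (cnt_le (cube_refl A l a ds) n)).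
by rewrite leq_mul2l ltnn orbF => /eqP k0; move: s0; rewrite k0.
Qed.

(* If a union [N] of translates avoids [A] and is nearly invariant under the
   step [D], then [A] misses [N] on most progressions of step [D], while on the
   other progressions its density is at most [g]. *)
Lemma density_off_invariant (A N : nat -> bool) (t D n e : nat) (g : R) :
  (0 < t)%N -> (0 < D)%N -> 0 <= g -> ap3_free A ->
  (forall A', ap3_free A' -> (cnt A' t)%:R <= g * t%:R) ->
  (forall y, N y -> A y -> False) ->
  (cnt (fun y => N y && ~~ N (y + D)) n <= e)%N ->
  (cnt A n)%:R <= g * (n%:R - (cnt N n)%:R) + (t * (e + t * D) + t * D)%:R.
Proof.
move=> t0 D0 g0 hA hg hNA he.
have t0R : 0 < t%:R :> R by rewrite ltr0n.
(* Being outside [N] after [i] steps means having left it at one of them; each costs [e], plus at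
   most [i * D] because its starting point is shifted. *)
have ex i : (cnt (fun y => N y && ~~ N (y + i * D)) n <= i * (e + i * D))%N.
  elim: i => [|i IH].
    by rewrite leqn0; apply/eqP/big1 => y _; rewrite addn0 andbN.
  apply: (@leq_trans (i * (e + i * D) + (e + i * D))); last by rewrite mulSn; nia.
  apply: (@leq_trans (cnt (fun y => N y && ~~ N (y + i * D)) n +
           cnt (fun y => N (y + i * D) && ~~ N (y + i * D + D)) n)).
    rewrite /cnt -big_split; apply: leq_sum => y _ /=.
    have -> : (y + i.+1 * D = y + i * D + D)%N by lia.
    by case: (N y); case: (N (y + i * D)%N); case: (N (y + i * D + D)%N).
  apply: leq_add => //.
  by apply: (leq_trans (cnt_shift_le (fun y => N y && ~~ N (y + D)) (i * D) n)); rewrite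
      leq_add2r.
have hw := cnt_window A t D n.
have : (t * cnt A n)%:R <= g * t%:R * (n%:R - (cnt N n)%:R) + (t * (t * (e + t * D)) + t * (t
    * D))%:R.
  apply: (@le_trans _ _ (\sum_(y < n) cnt (fun i => A (y + i * D)) t + t * (t * D))%:R).
    by rewrite ler_nat.
  rewrite natrD [X in _ <= _ + X]natrD addrA lerD2r natr_sum.
  have -> : n%:R - (cnt N n)%:R = \sum_(y < n) (~~ N y)%:R :> R.
    apply/eqP; rewrite subr_eq /cnt natr_sum -big_split /=.
    rewrite -[X in X%:R == _]card_ord -sumr_const; apply/eqP/eq_bigr => y _.
    by case: (N y); rewrite ?addr0 ?add0r.
  apply: (@le_trans _ _ (\sum_(y < n) (g * t%:R * (~~ N y)%:R +
      (cnt (fun i => N y && ~~ N (y + i * D)%N) t)%:R))).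
    apply: ler_sum => y _; case: (boolP (N y)) => hN; last first.
      rewrite mulr1 ler_wpDr //; apply: hg; exact: ap3_free_sub.
    rewrite mulr0 add0r ler_nat; apply: leq_cnt => i _ hAi.
    by apply/negP => hN'; exact: hNA hN' hAi.
  rewrite big_split /= -mulr_sumr lerD2l -natr_sum ler_nat exchange_big /=.
  rewrite -[X in (X * (_ * (_ + _)))%N]card_ord -sum_nat_const; apply: leq_sum => i _.
  apply: (leq_trans (ex i)); have it := ltnW (ltn_ord i).
  by apply: leq_mul => //; rewrite leq_add2l leq_mul2r it orbT.
rewrite natrM.
have -> : (t * (t * (e + t * D)) + t * (t * D))%:R = t%:R * (t * (e + t * D) + t * D)%:R :> R.
  by rewrite -natrM [in RHS]mulnDr.
by rewrite [g * _]mulrC -mulrA -mulrDr ler_pM2l.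
Qed.


Theorem roth (delta : R) : 0 < delta -> exists L : nat, (0 < L)%N /\
  forall A, ap3_free A -> (cnt A L)%:R < delta * L%:R.
Proof.
move=> delta0.
(* The infimum [c] of these bounds is the limiting density of progression-free sets; it is to be
   shown smaller than [delta]. *)
pose P : set R := [set b | exists2 t : nat, (0 < t)%N &
  forall A, ap3_free A -> (cnt A t)%:R <= b * t%:R].
have P1 : P 1.
  by exists 1%N => // A _; rewrite mul1r ler_nat cnt_le.
have free0 : ap3_free (fun=> false) by [].
have lbP : lbound P 0.
  move=> b [t t0 /(_ _ free0)]; rewrite /cnt big1 // => h.
  by move: h; rewrite pmulr_lge0 ?ltr0n.
have hinf : has_inf P by split; [exists 1 | exists 0].
set c := inf P.
have Pc eps : 0 < eps -> exists2 t : nat, (0 < t)%N &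
    forall A, ap3_free A -> (cnt A t)%:R <= (c + eps) * t%:R.
  move=> eps0; have [b [t t0 ht] hb] := inf_adherent eps0 hinf.
  exists t => // A hA; apply: le_trans (ht A hA) _.
  by rewrite ler_pM2r ?ltr0n // ltW.
have Pn eps n : 0 < eps -> (0 < n)%N -> exists2 A, ap3_free A & (c - eps) * n%:R < (cnt A n)%:R.
  move=> eps0 n0; apply: contrapT => hn.
  suff : P (c - eps).
    move=> /(ge_inf hinf.2); rewrite -/c; lra.
  exists n => // A hA; rewrite leNgt; apply/negP => h.
  by apply: hn; exists A.
have c0 : 0 <= c by apply: lb_le_inf => //; exists 1.
have c1 : c <= 1 by apply: ge_inf => //; exact: hinf.2.
have [cd|dc] := ltP c delta.
  have [t t0 ht] := Pc ((delta - c) / 2) ltac:(lra).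
  exists t; split=> // A hA; apply: le_lt_trans (ht A hA) _.
  by rewrite ltr_pM2r ?ltr0n //; lra.
have {c0}c0 : 0 < c by exact: lt_le_trans dc.
exfalso.
(* Quadratic in [c], because the gain from discarding the reflected points is of order [c ^+ 2]. *)
have [eps eps0 epsE] : exists2 eps, 0 < eps & eps = c ^+ 2 / 100.
  by exists (c ^+ 2 / 100) => //; rewrite divr_gt0 // exprn_gt0.
have [t t0 ht] := Pc _ eps0.
have t0R : 0 < t%:R :> R by rewrite ltr0n.
have c2_gt0 : 0 < c ^+ 2 by rewrite exprn_gt0.
have arch (x : R) : 0 <= x -> exists2 n : nat, (0 < n)%N & x < c ^+ 2 * n%:R.
  move=> x0; exists (Num.bound (x / c ^+ 2)).+1 => //.
  rewrite [ltRHS]mulrC -ltr_pdivrMr //; apply: lt_trans (archi_boundP _) _.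
    by rewrite divr_ge0 // ltW.
  by rewrite ltr_nat.
(* A cube of dimension [k] brings the number of exits down to about [4 * l / k]; [t] times this is
   at most [c ^+ 2 / 25 * l]. *)
have [k k_gt0 hk] := arch (100 * t%:R) ltac:(by rewrite mulr_ge0).
have c20 : 0 < c / 2 by rewrite divr_gt0.
have [q q0 hq] : exists2 q : nat, (0 < q)%N &
  forall A, c / 2 * q%:R <= (cnt A q)%:R ->
  exists a ds, [/\ size ds = k, all (fun d => 0 < d <= q)%N ds &
    all (fun m => A m && (m < q)%N) (hcube a ds)].
  by have [q hq] := hilbert_cube k c20; exists q.+1 => //; exact: hq.
(* The part of the error in [density_off_invariant] that does not grow with [l], for steps
   [2 * d <= 2 * q]; [l] is then chosen large against it. *)
have [E EE] : exists E, E = (t * (2 * q + t * (2 * q)) + t * (2 * q))%N by eexists.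
have [l [s [r [ls lr l0 hE]]]] : exists l s r, [/\ l = (s * t)%N, l = (r * q)%N, (0 < l)%N &
    100 * E%:R < c ^+ 2 * l%:R].
  have [u u0 hu] := arch (100 * E%:R) ltac:(by rewrite mulr_ge0).
  exists (u * q * t)%N, (u * q)%N, (u * t)%N; rewrite mulnAC !muln_gt0 u0 t0 q0; split=> //.
  apply: lt_le_trans hu _; rewrite ler_pM2l // ler_nat -mulnA.
  by rewrite leq_pmulr // muln_gt0 t0.
have l0R : 0 < l%:R :> R by rewrite ltr0n.
have [A hA hAl] := Pn eps (4 * l)%N eps0 ltac:(by rewrite muln_gt0).
have block A' a r1 : ap3_free A' -> (cnt (fun i => A' (a + i)%N) (r1 * t))%:R <= (c + eps) *
    (r1 * t)%:R.
  move=> hA'; elim: r1 => [|r1 IH].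
    by rewrite mul0n mulr0 /cnt big_ord0.
  rewrite mulSn addnC cntD !natrD mulrDr lerD //.
  have := ht (fun i => A' (a + (r1 * t + i))%N); apply => x d d0 h1 h2 h3.
  by apply: (hA' (a + (r1 * t + x))%N d) => //; rewrite -!addnA.
have cnt4 : cnt A (4 * l) = (cnt A l + (cnt (fun i => A (l + i)%N) l +
   cnt (fun i => A (2 * l + i)%N) (2 * l)))%N.
  have -> : (4 * l = l + (l + 2 * l))%N by clear; lia.
  rewrite cntD cntD; congr (_ + (_ + _))%N.
  by apply: eq_bigr => i _; rewrite addnA addnn -mul2n.
have b0 : (cnt A l)%:R <= (c + eps) * l%:R.
  by have := block A 0%N s hA; rewrite -ls.
have b1 : (cnt (fun i => A (l + i)%N) l)%:R <= (c + eps) * l%:R.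
  by have := block A l s hA; rewrite -ls.
have b2 : (cnt (fun i => A (2 * l + i)%N) (2 * l))%:R <= (c + eps) * (2 * l%:R).
  have := block A (2 * l)%N (2 * s)%N hA.
  by rewrite -mulnA -ls natrM.
have cnt4R : (cnt A (4 * l))%:R = (cnt A l)%:R + ((cnt (fun i => A (l + i)%N) l)%:R +
   (cnt (fun i => A (2 * l + i)%N) (2 * l))%:R) :> R by rewrite cnt4 !natrD.
move: hAl; rewrite natrM => hAl.
(* The interval of length [4 * l] has density above [c - eps] and each quarter at most [c + eps], so
   every quarter keeps at least [4 * (c - eps) - 3 * (c + eps)]. *)
have d0 : (c - 7 * eps) * l%:R <= (cnt A l)%:R.
  by move: hAl cnt4R b1 b2; clear; lra.
have d1 : (c - 7 * eps) * l%:R <= (cnt (fun i => A (l + i)%N) l)%:R.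
  by move: hAl cnt4R b0 b2; clear; lra.
have c7 : c / 2 <= c - 7 * eps.
  have : c ^+ 2 <= c by rewrite -[leRHS]mulr1 expr2 ler_pM2l.
  by move: c0; rewrite epsE; clear; lra.
(* The cube is sought in an interval whose length [q] was fixed before [l], so that its differences
   stay bounded while [l] grows. It lies in the second quarter, to the right of the points to be
   reflected. *)
have [b [bl hb]] : exists b, (b + q <= l)%N /\ c / 2 * q%:R <= (cnt (fun i => A (l + (b +
    i))%N) q)%:R.
  apply: contrapT => hn.
  have hr r' : (r' * q <= l)%N -> (0 < r')%N ->
      (cnt (fun i => A (l + i)%N) (r' * q))%:R < c / 2 * (r' * q)%:R.
    elim: r' => [//|r' IH] hr _.
    rewrite mulSn addnC cntD !natrD mulrDr.
    have hlast : (cnt (fun i => A (l + (r' * q + i))%N) q)%:R < c / 2 * q%:R.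
      rewrite ltNge; apply/negP => h; apply: hn; exists (r' * q)%N; split=> //.
      by rewrite addnC -mulSn.
    have [r0'|r0'] := posnP r'.
      by move: hlast; rewrite r0' !mul0n [cnt _ 0]big_ord0 mulr0 !add0r.
    by rewrite ltrD // IH // (leq_trans _ hr) // leq_mul2r leqnSn orbT.
  have r0 : (0 < r)%N by move: l0; rewrite lr muln_gt0 => /andP[].
  have := hr r; rewrite -lr leqnn => /(_ isT r0).
  by apply/negP; rewrite -leNgt; apply: le_trans d1; rewrite ler_pM2r.
have [a [ds [sds ads hc]]] := hq _ hb.
have hcube_shift a1 ds1 z : hcube (z + a1) ds1 = [seq (z + m)%N | m <- hcube a1 ds1].
  elim: ds1 => //= d ds1 ->; rewrite map_cat -!map_comp; congr (_ ++ _).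
  by apply: eq_map => x /=; rewrite addnA.
pose a' := (l + b + a)%N.
have hc' : all (fun m => A m && (l <= m < 2 * l)%N) (hcube a' ds).
  rewrite hcube_shift all_map; apply: sub_all hc => m /andP[h1 h2] /=.
  by rewrite -addnA h1 /=; move: h2 bl; clear; lia.
have ha' : (l <= a' < 2 * l)%N.
  have : a' \in hcube a' ds.
    by elim: (ds) => [|d ds1 IH] /=; rewrite ?inE ?eqxx // mem_cat IH.
  by move=> /(allP hc') /andP[].
have [|d [ds' [[dds sub hN] hN0]]] := @cube_refl_pigeonhole A l a' ds (4 * l)%N.
  by rewrite sds.
have /andP[dpos dq] := allP ads _ dds.
set N := cube_refl A l a' ds'.
have hfree y : N y -> A y -> False.
  apply: cube_refl_free => //; apply/allP => m /sub /(allP hc') /andP[-> /andP[-> _]] //.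
have hexit := cube_refl_exit A l a' d ds' (4 * l)%N.
rewrite -/N in hexit.
pose e := (cnt (fun y => N y && ~~ N (y + 2 * d)) (4 * l))%N.
have hdens := @density_off_invariant A N t (2 * d) (4 * l) e (c + eps) t0 _ _ hA ht hfree
    (leqnn _).
have {}hdens := hdens ltac:(by rewrite muln_gt0 dpos) ltac:(by rewrite addr_ge0 // ltW).
have hk1 : (k * e <= 4 * l + k * (2 * q))%N.
  move: hexit hN; rewrite -/e -/N sds; set u := cnt N _; set v := cnt _ _ => h1 h2.
  have : (k * (e + u) <= k * (v + 2 * d))%N by rewrite leq_mul2l h1 orbT.
  rewrite !mulnDr.
  have : (k * (2 * d) <= k * (2 * q))%N by rewrite leq_mul2l leq_mul2l dq !orbT.
  by move: h2; clear; lia.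
have hN1 : (cnt A l <= cnt N (4 * l))%N.
  by apply: leq_trans hN0; apply: cube_refl0; case/andP: ha'.
have hN1R : (c - 7 * eps) * l%:R <= (cnt N (4 * l))%:R.
  by apply: le_trans d0 _; rewrite ler_nat.
have errR : (t * (e + t * (2 * d)) + t * (2 * d))%:R <= t%:R * (e%:R - 2 * q%:R) + E%:R :> R.
  have -> : t%:R * (e%:R - 2 * q%:R) + E%:R = (t * (e + t * (2 * q)) + t * (2 * q))%:R :> R.
    by rewrite EE !natrD !natrM !natrD !natrM; ring.
  by rewrite ler_nat leq_add // leq_mul2l ?leq_add2l ?leq_mul2l ?dq ?orbT.
have hk1R : k%:R * e%:R <= 4 * l%:R + k%:R * (2 * q%:R) :> R.
  by rewrite -!natrM -natrD ler_nat.
have kpos : 0 < k%:R :> R by rewrite ltr0n.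
have te : t%:R * (e%:R - 2 * q%:R) <= c ^+ 2 / 25 * l%:R.
  have [h0|h0] := leP (e%:R - 2 * q%:R : R) 0.
    apply: (@le_trans _ _ 0); last by rewrite mulr_ge0 ?divr_ge0 ?exprn_ge0 // ltW.
    by rewrite mulr_ge0_le0 // ltW.
  rewrite -(ler_pM2l kpos).
  have h1 : t%:R * (k%:R * (e%:R - 2 * q%:R)) <= t%:R * (4 * l%:R) :> R.
    by rewrite ler_pM2l //; move: hk1R; clear; lra.
  have h2 : 100 * t%:R * l%:R <= c ^+ 2 * k%:R * l%:R by rewrite ler_pM2r // ltW.
  by move: h1 h2; clear; lra.
have final : (c - eps) * (4 * l%:R) <= (c + eps) * (4 * l%:R - (cnt N (4 * l))%:R) + (c ^+ 2
    / 25 * l%:R + E%:R).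
  apply: le_trans (ltW hAl) _; apply: le_trans hdens _.
  rewrite [X in _ * (X - _)]natrM; apply: lerD => //; apply: le_trans errR _.
  by rewrite lerD2r.
have cN : (c + eps) * ((c - 7 * eps) * l%:R) <= (c + eps) * (cnt N (4 * l))%:R.
  by apply: ler_wpM2l => //; apply: addr_ge0; exact: ltW.
have bad : (c + eps) * (c - 7 * eps) * l%:R <= (8 * eps + c ^+ 2 / 25 + c ^+ 2 / 100) * l%:R.
  by move: final cN hE; clear; lra.
move: bad; rewrite ler_pM2r // => bad.
(* The right side of [bad] is [13 * c ^+ 2 / 100], too small for this lower bound. *)
have : c * (c / 2) <= (c + eps) * (c - 7 * eps).
  by apply: ler_pM => //; [exact: ltW | exact: ltW | rewrite lerDl ltW].
by move: bad epsE c2_gt0; clear; lra.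
Qed.

End Roth.

(** * Two-step Lie groups *)

Section LieGroup.
Variables (R : realType) (G : lieGroup R).
Local Notation V := 'rV[R]_(lie_dim G).
Local Notation E := (@lie_exp R G).
Local Notation L := (@lie_log R G).
Local Notation br := (@lie_br R G).

Lemma lie_exp0 : E 0 = 1%g.
Proof.
have := lie_one_param (0 : R) 0 (0 : V); rewrite addr0 scale0r => h.
by apply: (@mulgI G (E 0)); rewrite -h mulg1.
Qed.

Lemma lie_log1 : L 1%g = 0.
Proof. by rewrite -lie_exp0 lie_expK. Qed.

Lemma lie_expN X : E (- X) = (E X)^-1%g.
Proof.
apply/esym/mulg1_eq; have := lie_one_param (1 : R) (-1) X.
by rewrite subrr scale0r scale1r scaleN1r lie_exp0.
Qed.

Lemma lie_logV x : L x^-1%g = - L x.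
Proof. by rewrite -{1}[x]lie_logK -lie_expN lie_expK. Qed.

Lemma lie_log_inj : injective L.
Proof. exact: can_inj (@lie_logK R G). Qed.

Lemma lie_logX x n : L (x ^+ n)%g = n%:R *: L x.
Proof.
elim: n => [|n IH]; first by rewrite expg0 scale0r lie_log1.
apply: (can_inj (@lie_expK R G)); rewrite lie_logK expgSr -natr1.
by rewrite lie_one_param -IH scale1r !lie_logK.
Qed.

Lemma cvg_lie_mul (T : Type) (F : set_system T) {FF : Filter F} (f g : T -> V) X Y :
  f @ F --> X -> g @ F --> Y -> (fun t => L (E (f t) * E (g t))%g) @ F --> L (E X * E Y)%g.
Proof.
move=> fX gY; have [hcont _] := @lie_smooth R G 0%N.
exact: (cvg_comp _ _ (cvg_pair fX gY) (hcont (X, Y))).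
Qed.

Lemma continuous_lie_mul (f g : R -> G) :
  continuous (L \o f) -> continuous (L \o g) -> continuous (fun t => L (f t * g t)%g).
Proof.
move=> hf hg t; have := cvg_lie_mul (hf t) (hg t).
have -> : (fun t => L (E ((L \o f) t) * E ((L \o g) t))%g) = (fun t => L (f t * g t)%g).
  by apply/funext => u /=; rewrite !lie_logK.
rewrite /continuous_at /= !lie_logK; apply; exact: nbhs_filter.
Qed.

Lemma continuous_lie_exp X : continuous (fun t : R => L (E (t *: X))).
Proof.
have -> : (fun t : R => L (E (t *: X))) = ( *:%R^~ X) by apply/funext => t; rewrite lie_expK.
exact: scalel_continuous.
Qed.

Lemma continuous_lie_inv (f : R -> G) :
  continuous (L \o f) -> continuous (fun t => L (f t)^-1%g).
Proof.
have -> : (fun t => L (f t)^-1%g) = (fun t => - L (f t)) by apply/funext => t; rewrite lie_logV.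
by move=> hf t; exact: cvgN (hf t).
Qed.

(* Roots are unique in [G], so a continuous homomorphism from the line agrees
   with the one-parameter subgroup through its value at 1 on the rationals. *)
Lemma lie_hom (g : R -> G) : (forall s t, g (s + t) = g s * g t)%g ->
  continuous (fun t => L (g t)) -> forall t, L (g t) = t *: L (g 1).
Proof.
move=> gD gc.
have gN n t : L (g (n%:R * t)) = n%:R *: L (g t).
  rewrite -lie_logX; congr (L _); elim: n => [|n IH].
    rewrite mul0r expg0; apply: (@mulgI _ (g 0)).
    by rewrite -gD addr0 mulg1.
  by rewrite -natr1 mulrDl mul1r gD IH expgSr.
have g0 : g 0 = 1%g by apply: (@mulgI _ (g 0)); rewrite -gD addr0 mulg1.
have gV t : L (g (- t)) = - L (g t).
  rewrite -lie_logV; congr (L _); apply/esym/mulg1_eq.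
  by rewrite -gD subrr.
have gZ (z : int) t : L (g (z%:~R * t)) = z%:~R *: L (g t).
  case: z => n; first exact: gN.
  by rewrite NegzE !mulrNz mulNr scaleNr gV gN.
have gq q : L (g (ratr q)) = ratr q *: L (g 1).
  have dn : (denq q)%:~R != 0 :> R by rewrite intr_eq0 denq_neq0.
  apply: (scalerI dn); rewrite -gZ scalerA /ratr mulrCA mulfV // mulr1 -gZ.
  by rewrite mulr1.
move=> t; apply/eqP; rewrite -subr_eq0.
pose h s := `|L (g s) - s *: L (g 1)|.
have hc : continuous h.
  move=> s; apply: cvg_norm; apply: cvgB; first exact: gc.
  exact: scalel_continuous.
have op : open (h @^-1` [set x | x != 0]).
  by apply: open_comp => // s _; exact: hc.
apply: contraT => ht.
have ht0 : (h @^-1` [set x | x != 0]) t by rewrite /= normr_eq0.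
have [s [hs [q _ qs]]] := @dense_rat R _ (ex_intro _ t ht0) op.
by move: hs; rewrite /= -qs /h gq subrr normr0 eqxx.
Qed.

(** Conjugation by [a] turns [t -> E (t *: X)] into a continuous homomorphism with the same value at
    1, so [lie_hom] identifies the two. *)
Lemma commute_lie_exp a X t : commute a (E X) -> commute a (E (t *: X)).
Proof.
move=> aX.
have h : forall t, L (a^-1 * E (t *: X) * a)%g = t *: L (a^-1 * E (1 *: X) * a)%g.
  apply: (@lie_hom (fun t => a^-1 * E (t *: X) * a)%g) => [s u|].
    by rewrite lie_one_param !mulgA mulgK.
  apply: (@continuous_lie_mul (fun t => a^-1 * E (t *: X))%g (fun=> a)).
    apply: (@continuous_lie_mul (fun=> a^-1)%g (fun t => E (t *: X))).
      by move=> ?; exact: cvg_cst.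
    exact: continuous_lie_exp.
  by move=> ?; exact: cvg_cst.
have e : (a^-1 * E X * a)%g = E X by rewrite -mulgA -aX mulKg.
move: (h t); rewrite scale1r e lie_expK => {}h.
have {}h : (a^-1 * E (t *: X) * a)%g = E (t *: X) by apply: lie_log_inj; rewrite h lie_expK.
by rewrite /commute -[in LHS]h !mulgA mulgV mul1g.
Qed.

(** A product of commuting one-parameter subgroups is again one, so by [lie_hom] the quotient in
    [lie_add] is constant and equals its limit. *)
Lemma lie_log_commute X Y : commute (E X) (E Y) -> L (E X * E Y)%g = X + Y.
Proof.
move=> cXY.
have h : forall t, L (E (t *: X) * E (t *: Y))%g = t *: L (E (1 *: X) * E (1 *: Y))%g.
  apply: (@lie_hom (fun t => E (t *: X) * E (t *: Y))%g) => [s t|].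
    rewrite !lie_one_param -!mulgA; congr (_ * _)%g; rewrite !mulgA; congr (_ * _)%g.
    apply: commute_lie_exp; apply: commute_sym; apply: commute_lie_exp; exact: commute_sym.
  by apply: continuous_lie_mul; exact: continuous_lie_exp.
rewrite !scale1r in h.
have := @lie_add R G X Y; move/cvg_lim => <- //; apply/esym/cvg_lim => //.
apply: cvg_near_cst; near=> t; rewrite h scalerA mulVf ?scale1r //.
by near: t; exact: nbhs_dnbhs_neq.
Unshelve. all: by end_near. Qed.

Hypothesis nil2 : forall x y z : G, commute [~ x, y]%g z.

Lemma commgMl (x y z : G) : [~ x * y, z]%g = ([~ x, z] * [~ y, z])%g.
Proof.
rewrite (commgEl (x * y)%g) invgM conjMg mulgA -[(y^-1 * x^-1 * _)%g]mulgA -commgEl.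
by rewrite -(nil2 x z) -mulgA -commgEl.
Qed.

(** In class two, commutators are multiplicative in each argument. By [lie_hom] the logarithm of
    [[~ E (t *: X), E (t *: Y)]] is then exactly [t ^+ 2] times its value at 1, and the quotient in
    [lie_bracket] is constant. *)
Lemma lie_bracketE X Y : [~ E X, E Y]%g = E (br X Y).
Proof.
have cR x (f : R -> G) : continuous (L \o f) -> continuous (fun t => L [~ f t, x]%g).
  move=> fc; apply: (@continuous_lie_mul (fun t => (f t)^-1)%g (fun t => f t ^ x)%g).
    exact: continuous_lie_inv.
  apply: (@continuous_lie_mul (fun=> x^-1)%g (fun t => f t * x)%g).
    by move=> ?; exact: cvg_cst.
  apply: (@continuous_lie_mul f (fun=> x)); first exact: fc.
  by move=> ?; exact: cvg_cst.
have hl x Z t : L [~ E (t *: Z), x]%g = t *: L [~ E Z, x]%g.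
  rewrite (@lie_hom (fun t => [~ E (t *: Z), x])%g) ?scale1r // => [s u|].
    by rewrite lie_one_param commgMl.
  by apply: cR; exact: continuous_lie_exp.
have hr x Z t : L [~ x, E (t *: Z)]%g = t *: L [~ x, E Z]%g.
  by rewrite -invgR lie_logV hl -scalerN -lie_logV invgR.
apply: lie_log_inj; rewrite lie_expK; apply/esym.
have := @lie_bracket R G X Y; move/cvg_lim => <- //; apply/cvg_lim => //.
apply: cvg_near_cst; near=> t; rewrite hl hr !scalerA -expr2 mulVf ?scale1r //.
by rewrite expf_neq0 //; near: t; exact: nbhs_dnbhs_neq.
Unshelve. all: by end_near. Qed.

Lemma lie_br_logE x y : br (L x) (L y) = L [~ x, y]%g.
Proof. by rewrite -[in RHS](lie_logK x) -[in RHS](lie_logK y) lie_bracketE lie_expK. Qed.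

Lemma lie_brC X Y : br Y X = - br X Y.
Proof. by rewrite -[X]lie_expK -[Y]lie_expK !lie_br_logE -lie_logV invgR. Qed.

Lemma lie_brXX X : br X X = 0.
Proof. by rewrite -[X]lie_expK lie_br_logE commgg lie_log1. Qed.

Lemma lie_br_central X Y Z : br X (lie_br Y Z) = 0.
Proof.
rewrite -[X]lie_expK -[Y]lie_expK -[Z]lie_expK !lie_br_logE -lie_log1; congr (L _).
by apply/eqP/commgP; apply: commute_sym; apply: nil2.
Qed.

Lemma lie_brZl t X Y : br (t *: X) Y = t *: br X Y.
Proof.
have cx : continuous (fun t : R => L [~ E (t *: X), E Y]%g).
  apply: (@continuous_lie_mul (fun t => (E (t *: X))^-1)%g (fun t => E (t *: X) ^ E Y)%g).
    by apply: continuous_lie_inv; exact: continuous_lie_exp.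
  apply: (@continuous_lie_mul (fun=> (E Y)^-1)%g (fun t => E (t *: X) * E Y)%g).
    by move=> ?; exact: cvg_cst.
  apply: (@continuous_lie_mul (fun t => E (t *: X)) (fun=> E Y)).
    exact: continuous_lie_exp.
  by move=> ?; exact: cvg_cst.
have h s u : ([~ E ((s + u) *: X), E Y] = [~ E (s *: X), E Y] * [~ E (u *: X), E Y])%g.
  by rewrite lie_one_param commgMl.
have := @lie_hom (fun t => [~ E (t *: X), E Y]%g) h cx t.
by rewrite !lie_bracketE !lie_expK scale1r.
Qed.

Lemma lie_brZr t X Y : br X (t *: Y) = t *: br X Y.
Proof. by rewrite lie_brC lie_brZl -scalerN -lie_brC. Qed.

Let central_swap (a b c d x y w : G) : (forall v, commute x v) -> (forall v, commute w v) ->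
  (b * c = c * b * w -> (a * c) * (b * d) * (x * y * w) = (a * b * x) * (c * d * y))%g.
Proof.
move=> xc wc bc; apply/esym.
rewrite -(mulgA (a * b)%g) (mulgA x) (xc (c * d)%g) !mulgA -(mulgA a b c) bc !mulgA.
rewrite -(mulgA _ w d) (wc d) mulgA -(mulgA _ w x) (wc x) mulgA.
by rewrite -(mulgA _ w y) (wc y) mulgA.
Qed.

(** The central factor in [g] cancels the commutators that arise when [E (t *: X) * E (t *: Y)] is
    multiplied out, so [g] is a one-parameter subgroup; [lie_add] identifies its generator [W] as
    [X + Y]. *)
Lemma lie_log_mul X Y : L (E X * E Y)%g = X + Y + 2^-1 *: br X Y.
Proof.
pose Z u := E (u *: br X Y).
have Zc u y : commute (Z u) y.
  apply: commute_sym; apply: commute_lie_exp; rewrite -lie_bracketE.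
  by apply: commute_sym; exact: nil2.
have ZD u v : Z (u + v) = (Z u * Z v)%g by rewrite /Z lie_one_param.
have Z0 : Z 0 = 1%g by rewrite /Z scale0r lie_exp0.
pose g t := (E (t *: X) * E (t *: Y) * Z (- (t ^+ 2 / 2))%R)%g.
have gD s t : g (s + t) = (g s * g t)%g.
  have -> : g (s + t) = ((E (s *: X) * E (t *: X)) * (E (s *: Y) * E (t *: Y)) *
     (Z (- (s ^+ 2 / 2))%R * Z (- (t ^+ 2 / 2))%R * Z (- (s * t))%R))%g.
    by rewrite -!ZD /g !lie_one_param; congr (_ * Z _)%g; field.
  apply: central_swap => //.
  have -> : (E (t *: X) * E (s *: Y) = E (s *: Y) * E (t *: X) * Z (s * t)%R)%g.
    by rewrite commgC lie_bracketE lie_brZl lie_brZr scalerA [(t * s)%R]mulrC.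
  by rewrite -mulgA -ZD subrr Z0 mulg1.
have gc : continuous (fun t => L (g t)).
  apply: (@continuous_lie_mul (fun t => E (t *: X) * E (t *: Y))%g (fun t => Z (- (t ^+ 2 /
      2))%R)).
    by apply: (@continuous_lie_mul (fun t => E (t *: X)) (fun t => E (t *: Y)));
      exact: continuous_lie_exp.
  move=> t; have -> : (L \o (fun t => Z (- (t ^+ 2 / 2))%R)) = (fun t => (- (t ^+ 2 / 2)) *:
      br X Y).
    by apply/funext => u; rewrite /= /Z lie_expK.
  by apply: cvgZr_tmp; apply: cvgN; apply: cvgMr_tmp; exact: exprn_continuous.
have hg := lie_hom gD gc.
set W := L (g 1) in hg.
have gE t : L (E (t *: X) * E (t *: Y))%g = t *: W + (t ^+ 2 / 2) *: br X Y.
  rewrite -lie_log_commute; last by apply: commute_sym; exact: Zc.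
  by rewrite -hg lie_logK /g -/(Z _) -mulgA -ZD addNr Z0 mulg1.
have WE : W = X + Y.
  have h1 : t^-1 *: L (E (t *: X) * E (t *: Y))%g @[t --> 0^'] --> W.
    have : W + (t / 2) *: br X Y @[t --> (0:R)^'] --> W + (0 / 2) *: br X Y.
      apply: cvgD; first exact: cvg_cst.
      apply: cvgZr_tmp; apply: cvgMr_tmp; exact: nbhs_dnbhs.
    rewrite mul0r scale0r addr0; apply: cvg_trans; apply: near_eq_cvg; near=> t.
    have t0 : t != 0 by near: t; exact: nbhs_dnbhs_neq.
    by rewrite gE scalerDr !scalerA mulVf // scale1r expr2 -mulrA mulKf.
  have := @lie_add R G X Y; move/cvg_lim => <- //; apply/esym.
  by move/cvg_lim : h1; apply.
by have := gE 1; rewrite !scale1r WE expr1n mul1r.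
Unshelve. all: by end_near. Qed.

(** [E X * E Y] and [E (X + Y)] differ by a central factor, which commutators do not see. *)
Lemma lie_brDl X Y Z : br (X + Y) Z = br X Z + br Y Z.
Proof.
have h : (E X * E Y)%g = (E (X + Y) * E (2^-1 *: br X Y))%g.
  apply: lie_log_inj; rewrite lie_log_mul lie_log_mul lie_brZr lie_br_central.
  by rewrite !scaler0 addr0.
have hz : [~ E (2^-1 *: br X Y), E Z]%g = 1%g.
  by rewrite lie_bracketE lie_brC lie_brZr lie_br_central scaler0 oppr0 lie_exp0.
rewrite -[LHS]lie_expK -lie_bracketE -[E (X + Y)]mulg1 -[RHS]lie_expK.
have -> : [~ E (X + Y) * 1, E Z]%g = [~ E X * E Y, E Z]%g.
  by rewrite mulg1 h commgMl hz mulg1.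
rewrite commgMl !lie_bracketE -lie_log_commute ?lie_logK //.
by rewrite -lie_bracketE; exact: nil2.
Qed.

Lemma lie_brDr X Y Z : br Z (X + Y) = br Z X + br Z Y.
Proof. by rewrite lie_brC lie_brDl opprD -!lie_brC. Qed.

End LieGroup.

(** * Mal'cev coordinates *)

Section RowNorm.
Variables (R : realType) (m : nat).
Implicit Types x : 'rV[R]_m.

Lemma row_norm_ge x i : `|x 0 i| <= `|x|.
Proof.
by rewrite [leRHS]/Num.norm /= mx_normrE; apply/bigmax_geP; right => /=; exists (0, i).
Qed.

Lemma row_norm_le x e : 0 <= e -> (forall i, `|x 0 i| <= e) -> `|x| <= e.
Proof.
move=> e0 h; rewrite [leLHS]/Num.norm /= mx_normrE; apply: bigmax_le => // -[i j] _ /=.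
by rewrite (ord1 i).
Qed.

End RowNorm.

Section CoordinateBracket.
Variables (R : realType) (m : nat) (c : 'I_m -> 'I_m -> 'I_m -> R).
Implicit Types x y : 'rV[R]_m.

(** Defined for any array [c], with no group behind it, because the codes below enumerate arrays
    without knowing which of them come from a Lie group. *)
Definition cbr x y : 'rV[R]_m := \row_k \sum_i \sum_j x 0 i * y 0 j * c i j k.

Definition cmul x y : 'rV[R]_m := x + y + 2^-1 *: cbr x y.

Lemma cbrDl x1 x2 y : cbr (x1 + x2) y = cbr x1 y + cbr x2 y.
Proof.
apply/rowP => k; rewrite !mxE -big_split; apply: eq_bigr => i _.
by rewrite -big_split; apply: eq_bigr => j _; rewrite mxE !mulrDl.
Qed.

Lemma cbrDr x y1 y2 : cbr x (y1 + y2) = cbr x y1 + cbr x y2.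
Proof.
apply/rowP => k; rewrite !mxE -big_split; apply: eq_bigr => i _.
by rewrite -big_split; apply: eq_bigr => j _; rewrite mxE mulrDr mulrDl.
Qed.

Lemma cbrZl a x y : cbr (a *: x) y = a *: cbr x y.
Proof.
apply/rowP => k; rewrite !mxE mulr_sumr; apply: eq_bigr => i _.
by rewrite mulr_sumr; apply: eq_bigr => j _; rewrite mxE !mulrA.
Qed.

Lemma cbrZr a x y : cbr x (a *: y) = a *: cbr x y.
Proof.
apply/rowP => k; rewrite !mxE mulr_sumr; apply: eq_bigr => i _.
by rewrite mulr_sumr; apply: eq_bigr => j _; rewrite mxE !mulrA [_ * a]mulrC.
Qed.

Lemma cbr0l y : cbr 0 y = 0.
Proof. by rewrite -[0 in LHS](scale0r 0) cbrZl scale0r. Qed.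

Lemma cbrNr x y : cbr x (- y) = - cbr x y.
Proof. by rewrite -scaleN1r cbrZr scaleN1r. Qed.

Lemma cbrNl x y : cbr (- x) y = - cbr x y.
Proof. by rewrite -scaleN1r cbrZl scaleN1r. Qed.

Lemma cbr_norm (M : R) x y : 0 <= M -> (forall i j k, `|c i j k| <= M) ->
  `|cbr x y| <= (m * m)%:R * M * `|x| * `|y|.
Proof.
move=> M0 cM; apply: row_norm_le => [|k]; first by rewrite !mulr_ge0.
rewrite mxE; apply: (le_trans (ler_norm_sum _ _ _)).
have -> : (m * m)%:R * M * `|x| * `|y| = \sum_(i < m) \sum_(j < m) (`|x| * `|y| * M).
  by rewrite !sumr_const !card_ord -mulrnA -mulr_natl; ring.
apply: ler_sum => i _; apply: (le_trans (ler_norm_sum _ _ _)); apply: ler_sum => j _.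
rewrite !normrM; apply: ler_pM => //; rewrite ?mulr_ge0 //.
by apply: ler_pM => //; exact: row_norm_ge.
Qed.

End CoordinateBracket.

Section MalcevDistance.
Variables (R : realType) (G : lieGroup R) (B : 'M[R]_(lie_dim G)).

Lemma malcev_dist_ge0 x y : 0 <= malcev_dist B x y.
Proof.
apply: lb_le_inf; first by exists (chain_cost B x [:: y]), [:: y].
move=> _ [s _ <-]; elim: s x => //= w s IH x.
by rewrite addr_ge0 // /step_cost le_min !normr_ge0.
Qed.

Lemma coset_dist_ge0 (a b : set G) :
  0 <= coset_dist B a b.
Proof.
rewrite /coset_dist; set X := [set _ | _ in _ & _ in _].
have [[x Xx]|/set0P/negP/negPn/eqP ->] := pselect (X !=set0); last by rewrite inf0.
apply: lb_le_inf; first by exists x.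
by move=> _ [u _ [v _ <-]]; exact: malcev_dist_ge0.
Qed.

End MalcevDistance.

(* Bounds the first [n] Mal'cev coordinates of the second kind near the
   identity, for structure constants bounded by [M] in dimension [d]. *)
Fixpoint malcev_const (R : realType) (d : nat) (M : R) (n : nat) : R :=
  if n is n'.+1 then
    malcev_const d M n' + (d ^ 3)%:R * M * malcev_const d M n' ^+ 2
  else 1.

Lemma malcev_const_ge1 (R : realType) d (M : R) n : 0 <= M -> 1 <= malcev_const d M n.
Proof.
move=> M0; elim: n => //= n IH; apply: le_trans IH _.
by rewrite lerDl; apply: mulr_ge0; [exact: mulr_ge0 | exact: sqr_ge0].
Qed.

Section MalcevCoordinates.
Variables (R : realType) (G : lieGroup R) (B : 'M[R]_(lie_dim G)) (F : nat -> set G).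
Hypothesis nil2 : forall x y z : G, commute [~ x, y]%g z.
Hypothesis malcev : is_malcev_basis B F.
Local Notation m := (lie_dim G).
Local Notation V := 'rV[R]_m.
Local Notation E := (@lie_exp R G).
Local Notation L := (@lie_log R G).
Local Notation br := (@lie_br R G).
Local Notation c := (struct_const B).

Let uB : B \in unitmx. Proof. by case: malcev. Qed.

Lemma bcoordK X : bcoord B X *m B = X.
Proof. by rewrite /bcoord mulmxKV. Qed.

Lemma bcoord_mulmx X : bcoord B (X *m B) = X.
Proof. by rewrite /bcoord mulmxK. Qed.

Lemma bcoordD X Y : bcoord B (X + Y) = bcoord B X + bcoord B Y.
Proof. by rewrite /bcoord mulmxDl. Qed.

Lemma bcoordZ a X : bcoord B (a *: X) = a *: bcoord B X.
Proof. by rewrite /bcoord -scalemxAl. Qed.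

Lemma bcoordN X : bcoord B (- X) = - bcoord B X.
Proof. by rewrite /bcoord mulNmx. Qed.

Lemma bcoord_row i : bcoord B (row i B) = delta_mx 0 i.
Proof. by rewrite rowE bcoord_mulmx. Qed.

Lemma lie_br_suml (I : Type) (r : seq I) (P : pred I) (f : I -> V) Y :
  br (\sum_(i <- r | P i) f i) Y = \sum_(i <- r | P i) br (f i) Y.
Proof.
apply: (big_morph (fun X => br X Y)) => [X X'|]; first exact: lie_brDl.
by have := lie_brZl nil2 0 0 Y; rewrite !scale0r.
Qed.

Lemma lie_br_sumr (I : Type) (r : seq I) (P : pred I) (f : I -> V) X :
  br X (\sum_(i <- r | P i) f i) = \sum_(i <- r | P i) br X (f i).
Proof.
by rewrite lie_brC // lie_br_suml -sumrN; apply: eq_bigr => i _; rewrite -lie_brC.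
Qed.

Lemma bcoord_sum (I : Type) (r : seq I) (P : pred I) (f : I -> V) :
  bcoord B (\sum_(i <- r | P i) f i) = \sum_(i <- r | P i) bcoord B (f i).
Proof. exact: mulmx_suml. Qed.

Lemma bcoord_br X Y : bcoord B (br X Y) = cbr c (bcoord B X) (bcoord B Y).
Proof.
rewrite -{1}[X]bcoordK -{1}[Y]bcoordK !mulmx_sum_row lie_br_suml.
apply/rowP => k; rewrite [RHS]mxE bcoord_sum summxE; apply: eq_bigr => i _.
have eZ a (v : V) : (a *: v) 0 k = a * v 0 k by rewrite mxE.
rewrite lie_brZl // lie_br_sumr bcoordZ eZ bcoord_sum summxE mulr_sumr.
by apply: eq_bigr => j _; rewrite lie_brZr // bcoordZ eZ mulrA.
Qed.

Definition lcoord (x : G) : V := bcoord B (L x).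
Definition lpoint (v : V) : G := E (v *m B).

Lemma lpointK : cancel lpoint lcoord.
Proof. by move=> v; rewrite /lcoord /lpoint lie_expK bcoord_mulmx. Qed.

Lemma lcoordK : cancel lcoord lpoint.
Proof. by move=> x; rewrite /lcoord /lpoint bcoordK lie_logK. Qed.

Lemma lcoordM x y : lcoord (x * y)%g = cmul c (lcoord x) (lcoord y).
Proof.
rewrite /lcoord -{1}[x]lie_logK -{1}[y]lie_logK lie_log_mul //.
by rewrite !bcoordD bcoordZ bcoord_br.
Qed.

Lemma lcoordV x : lcoord x^-1%g = - lcoord x.
Proof. by rewrite /lcoord lie_logV bcoordN. Qed.

Lemma lcoord1 : lcoord 1%g = 0.
Proof. by rewrite /lcoord lie_log1 /bcoord mul0mx. Qed.

Lemma lcoordX x n : lcoord (x ^+ n)%g = n%:R *: lcoord x.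
Proof. by rewrite /lcoord lie_logX bcoordZ. Qed.

Lemma cbrC v w : cbr c w v = - cbr c v w.
Proof.
rewrite -[v]bcoord_mulmx -[w]bcoord_mulmx -!bcoord_br lie_brC //.
by rewrite bcoordN.
Qed.

Lemma cbr_center u v w : cbr c u (cbr c v w) = 0.
Proof.
rewrite -[u]bcoord_mulmx -[v]bcoord_mulmx -[w]bcoord_mulmx -!bcoord_br.
by rewrite lie_br_central // /bcoord mul0mx.
Qed.

(** For [k < j] this is the ideal property of the tails. For [k = j], bracketing twice with the i-th
    basis vector gives 0 in class two, while the j-th coordinate of the result is [c i j j ^+ 2]. *)
Lemma struct_const_triangular (i j k : 'I_m) : (k <= j)%N -> c i j k = 0.
Proof.
case: malcev => _ tail _ _ _ kj.
have neq (l l' : 'I_m) : (l < l')%N -> (l == l') = false.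
  by move=> ll; rewrite -val_eqE /= ltn_eqF.
have rowj : tail_span B j (row j B).
  by move=> l lj; rewrite bcoord_row mxE (neq _ _ lj) andbF.
have h : forall l : 'I_m, (l < j)%N -> c i j l = 0 by move=> l; exact: (tail j (row i B) _
    rowj).
case: (ltngtP k j) kj => [kj|//|/val_inj -> _]; first by rewrite h.
pose Z := br (row i B) (row j B) - c i j j *: row j B.
have hZ (l : 'I_m) : (l <= j)%N -> bcoord B Z 0 l = 0.
  have -> : bcoord B Z 0 l = c i j l - c i j j * (delta_mx 0 j : V) 0 l.
    by rewrite /Z bcoordD bcoordN bcoordZ bcoord_row mxE [(- _ : V) _ _]mxE [(_ *: _ : V) _
        _]mxE.
  rewrite leq_eqVlt mxE eqxx /=.
  case/orP => [/eqP/val_inj ->|lj]; first by rewrite eqxx mulr1 subrr.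
  by rewrite h // (neq _ _ lj) mulr0 subrr.
have := lie_br_central nil2 (row i B) (row i B) (row j B).
have -> : br (row i B) (row j B) = c i j j *: row j B + Z by rewrite /Z addrC subrK.
rewrite lie_brDr // lie_brZr // => /(congr1 (fun X => bcoord B X 0 j)).
have e a (v w : V) : (a *: v + w) 0 j = a * v 0 j + w 0 j by rewrite !mxE.
rewrite bcoordD bcoordZ e [in X in _ = X -> _]/bcoord mul0mx [X in _ = X -> _]mxE -/(c i j j).
have -> : bcoord B (br (row i B) Z) 0 j = 0.
  by apply: (tail j.+1) => // l; rewrite ltnS; exact: hZ.
by rewrite addr0 => /eqP; rewrite mulf_eq0 orbb => /eqP.
Qed.

Lemma struct_const_anti i j k : c i j k = - c j i k.
Proof.
rewrite /struct_const lie_brC // bcoordN.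
by rewrite mxE.
Qed.

Section ExpProd.
Variable t : V.

(** Extended by 0 beyond [m], so that partial products can be indexed by [nat]. *)
Let u (n : nat) : V := if insub n is Some i then t 0 i *: delta_mx 0 i else 0.
Let T n : V := \sum_(l < n) u l.
Let Q n : V := \sum_(l < n) cbr c (T l) (u l).

Let uE n (i : 'I_m) : u n 0 i = if (i : nat) == n then t 0 i else 0.
Proof.
rewrite /u; case: insubP => [j jm jn|nm].
  rewrite !mxE eqxx /= -jn val_eqE; case: eqP => [->|_]; first by rewrite mulr1.
  by rewrite mulr0.
by rewrite mxE; case: eqP => // e; move: nm; rewrite -e ltn_ord.
Qed.

Let TE n (i : 'I_m) : T n 0 i = if (i < n)%N then t 0 i else 0.
Proof.
elim: n => [|n IH]; first by rewrite /T big_ord0 mxE.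
rewrite /T big_ord_recr /= -/(T n) mxE IH uE [(i < n.+1)%N]ltnS [(i <= n)%N]leq_eqVlt.
by case: (ltngtP i n) => /= _; rewrite ?addr0 ?add0r.
Qed.

Let cbrQ n v : cbr c (Q n) v = 0.
Proof.
elim: n => [|n IH]; first by rewrite /Q big_ord0 cbr0l.
by rewrite /Q big_ord_recr /= -/(Q n) cbrDl IH add0r cbrC cbr_center oppr0.
Qed.

(** Each new factor contributes only its bracket with the linear part [T], since [Q], a sum of
    brackets, is central. *)
Lemma lcoord_exp_prod : lcoord (exp_prod B t) = T m + 2^-1 *: Q m.
Proof.
pose X (n : nat) : G := if insub n is Some i then E (t 0 i *: row i B) else 1%g.
have -> : exp_prod B t = (\prod_(i < m) X i)%g.
  by apply: eq_bigr => i _; rewrite /X valK.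
have Xu n : lcoord (X n) = u n.
  rewrite /X /u; case: insubP => [i _ _|_]; last exact: lcoord1.
  by rewrite /lcoord lie_expK bcoordZ bcoord_row.
have h n : lcoord (\prod_(i < n) X i)%g = T n + 2^-1 *: Q n; last exact: h.
elim: n => [|n IH]; first by rewrite /T /Q !big_ord0 lcoord1 scaler0 addr0.
rewrite big_ord_recr /= lcoordM IH Xu /cmul cbrDl cbrZl cbrQ scaler0 addr0.
by rewrite /T /Q !big_ord_recr /= -/(T n) -/(Q n) scalerDr addrACA addrA.
Qed.

(** By triangularity in both lower indices, the k-th coordinate of [Q] involves only the [t 0 i]
    with [i < k], so these coordinates can be bounded one after another. *)
Lemma exp_prod_coord_le (M tau : R) (k : 'I_m) : 0 <= M ->
  (forall i j l, `|c i j l| <= M) -> (forall i : 'I_m, (i < k)%N -> `|t 0 i| <= tau) ->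
  `|t 0 k| <= `|lcoord (exp_prod B t) 0 k| + (m ^ 3)%:R * M * tau ^+ 2.
Proof.
move=> M0 cM ttau.
have ck (i j : 'I_m) : (k <= i)%N || (k <= j)%N -> c i j k = 0.
  case/orP => h; last exact: struct_const_triangular.
  by rewrite struct_const_anti struct_const_triangular ?oppr0.
have hQ : `|Q m 0 k| <= (m ^ 3)%:R * M * tau ^+ 2.
  have -> : (m ^ 3)%:R * M * tau ^+ 2 = \sum_(l < m) \sum_(i < m) \sum_(j < m) (tau * tau * M).
    by rewrite !sumr_const !card_ord -!mulrnA -mulr_natl !expnS expn0 muln1 !mulnA; ring.
  rewrite summxE; apply: (le_trans (ler_norm_sum _ _ _)); apply: ler_sum => l _.
  rewrite mxE; apply: (le_trans (ler_norm_sum _ _ _)); apply: ler_sum => i _.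
  apply: (le_trans (ler_norm_sum _ _ _)); apply: ler_sum => j _.
  have [h|] := boolP ((k <= i)%N || (k <= j)%N).
    by rewrite ck // mulr0 normr0 mulr_ge0 // -expr2 sqr_ge0.
  rewrite negb_or -!ltnNge => /andP[ik jk].
  rewrite !normrM; apply: ler_pM; rewrite ?mulr_ge0 ?normr_ge0 //.
  apply: ler_pM; rewrite ?normr_ge0 // ?TE ?uE.
    case: ifP => _; first exact: ttau.
    by rewrite normr0 (le_trans _ (ttau i ik)).
  case: ifP => _; first exact: ttau.
  by rewrite normr0 (le_trans _ (ttau i ik)).
have -> : t 0 k = lcoord (exp_prod B t) 0 k - 2^-1 * Q m 0 k.
  by rewrite lcoord_exp_prod mxE [(_ *: Q m) 0 k]mxE addrK TE ltn_ord.
apply: (le_trans (ler_normB _ _)); rewrite lerD2l.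
apply: le_trans hQ; rewrite normrM [ `|2^-1| ]ger0_norm ?invr_ge0 //.
by rewrite ler_piMl ?normr_ge0 // invf_le1 // ler1n.
Qed.

End ExpProd.

Lemma exp_prod_malcev x : exp_prod B (malcev_coord B x) = x.
Proof.
case: malcev => _ _ _ [g _ gK] _.
by rewrite /malcev_coord; case: xgetP => [t -> //|/(_ (g x))]; rewrite /= gK.
Qed.

(** Logarithmic coordinates of norm at most 1 dominate their own squares, which keeps the recursion
    linear in them. *)
Lemma malcev_coord_le M x : 0 <= M -> (forall i j l, `|c i j l| <= M) ->
  `|lcoord x| <= 1 -> `|malcev_coord B x| <= malcev_const m M m * `|lcoord x|.
Proof.
move=> M0 cM x1; set t := malcev_coord B x.
have Apos n : 0 <= malcev_const m M n by rewrite (le_trans _ (malcev_const_ge1 m n M0)).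
have h n : (n <= m)%N -> forall k : 'I_m, (k < n)%N -> `|t 0 k| <= malcev_const m M n *
    `|lcoord x|.
  elim: n => // n IH nm k; rewrite ltnS => kn.
  have tk (i : 'I_m) : (i < k)%N -> `|t 0 i| <= malcev_const m M n * `|lcoord x|.
    by move=> ik; apply: IH; [exact: ltnW | exact: leq_trans kn].
  apply: (le_trans (exp_prod_coord_le M0 cM tk)); rewrite exp_prod_malcev /= mulrDl.
  apply: lerD.
    apply: (le_trans (row_norm_ge _ _)); rewrite ler_peMl //; exact: malcev_const_ge1.
  rewrite -[leRHS]mulrA; apply: ler_wpM2l; first exact: mulr_ge0.
  by rewrite exprMn; apply: ler_wpM2l; rewrite ?sqr_ge0 // expr2 ler_piMr.
apply: row_norm_le => [|k]; first by rewrite mulr_ge0.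
exact: h.
Qed.

Lemma malcev_dist_le M x y : 0 <= M -> (forall i j l, `|c i j l| <= M) ->
  `|lcoord (x / y)%g| <= 1 -> malcev_dist B x y <= malcev_const m M m * `|lcoord (x / y)%g|.
Proof.
move=> M0 cM h; apply: le_trans (malcev_coord_le M0 cM h).
have chain0 a s : 0 <= chain_cost B a s.
  by elim: s a => //= b s IH a; rewrite addr_ge0 // le_min !normr_ge0.
apply: (@le_trans _ _ (step_cost B x y)); last by rewrite /step_cost ge_min lexx.
apply: ge_inf; first by exists 0 => _ [s _ <-].
by exists [:: y] => //=; rewrite addr0.
Qed.

Lemma coset_dist_le M (a b : set G) x y : 0 <= M -> (forall i j l, `|c i j l| <= M) ->
  a x -> b y -> `|lcoord (x / y)%g| <= 1 ->
  coset_dist B a b <= malcev_const m M m * `|lcoord (x / y)%g|.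
Proof.
move=> M0 cM ax hb h; apply: le_trans (malcev_dist_le M0 cM h).
apply: ge_inf; first by exists 0 => _ [u _ [v _ <-]]; exact: malcev_dist_ge0.
by exists x => //; exists y.
Qed.

(** As [cbr c w w = 0], the bracket of [v] with [w] is that of [v - w] with [w]; hence passing from
    differences of coordinates to [x / y] costs only a factor linear in [y]. *)
Lemma lcoord_div_le M x y : 0 <= M -> (forall i j l, `|c i j l| <= M) ->
  `|lcoord (x / y)%g| <= `|lcoord x - lcoord y| * (1 + (m * m)%:R * M * `|lcoord y|).
Proof.
move=> M0 cM; rewrite lcoordM lcoordV /cmul; set v := lcoord x; set w := lcoord y.
have ww : cbr c w w = 0.
  by rewrite -[w]bcoord_mulmx -bcoord_br lie_brXX // /bcoord mul0mx.
have -> : cbr c v (- w) = - cbr c (v - w) w by rewrite cbrNr cbrDl cbrNl ww subr0.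
rewrite mulrDr mulr1; apply: (le_trans (ler_normD _ _)); rewrite lerD2l.
rewrite normrZ normrN [ `|2^-1| ]ger0_norm ?invr_ge0 //.
have := cbr_norm (v - w) w M0 cM; set z := `|cbr _ _ _| => hz.
apply: (@le_trans _ _ z); first by rewrite ler_piMl ?normr_ge0 // invf_le1 // ler1n.
by apply: le_trans hz _; rewrite le_eqVlt; apply/orP; left; apply/eqP; ring.
Qed.

End MalcevCoordinates.

(** * Two-step polynomial sequences *)

Section TwoStepGroup.
Variable (G : groupType).

Lemma two_step_central (F : nat -> set G) : is_filtration 2 F -> forall x y z : G, commute [~
    x, y]%g z.
Proof.
case=> [[_ F1] _ _ F3 FR] x y z; apply: commute_sym; apply/commgP/eqP.
have h : F 2%N [~ x, y]%g by apply: (FR 1%N 1%N); rewrite F1.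
have : F (1 + 2)%N [~ z, [~ x, y]]%g by apply: FR => //; rewrite F1.
by rewrite F3.
Qed.

Lemma two_step_F2_central (F : nat -> set G) : is_filtration 2 F -> forall x z, F 2%N x ->
    commute x z.
Proof.
case=> [[_ F1] _ _ F3 FR] x z hx; apply: commute_sym; apply/commgP/eqP.
have : F (1 + 2)%N [~ z, x]%g by apply: FR => //; rewrite F1.
by rewrite F3.
Qed.

(** Third derivatives lie in the trivial group [F 3], so the second derivative is constant, and
    central as an element of [F 2]; sum it twice. *)
Lemma polynomial_two_step (F : nat -> set G) (p : int -> G) :
  is_filtration 2 F -> is_polynomial F p -> exists g0 g1 z, F 2%N z /\
  forall n : nat, p n%:Z = (z ^+ 'C(n, 2) * g1 ^+ n * g0)%g.
Proof.
move=> hF hp; pose q := gderiv 1 p; pose r := gderiv 1 q.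
have hr n : F 2%N (r n) by apply: (hp [:: 1; 1]).
have hs n : r (n + 1) = r n.
  apply: divg1_eq; have := hp [:: 1; 1; 1] n.
  by case: hF => [_ _ _ -> //].
have rn (n : nat) : r n%:Z = r 0.
  by elim: n => // n <-; rewrite -addn1 PoszD hs.
have zc x : commute (r 0) x by apply: (two_step_F2_central hF).
have qn (n : nat) : q n%:Z = (r 0 ^+ n * q 0)%g.
  elim: n => [|n IH]; first by rewrite expg0 mul1g.
  have -> : q n.+1%:Z = (r n%:Z * q n%:Z)%g by rewrite /r /gderiv mulgVK -PoszD addn1.
  by rewrite rn IH mulgA -expgS.
exists (p 0), (q 0), (r 0); split => // n.
elim: n => [|n IH]; first by rewrite bin0n !expg0 !mul1g.
have -> : p n.+1%:Z = (q n%:Z * p n%:Z)%g by rewrite /q /gderiv mulgVK -PoszD addn1.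
rewrite qn IH binS bin1 addnC expgnDr expgS; move: (q 0) (zc (q 0)) => q0 zq.
rewrite !mulgA; congr (_ * _ * _)%g; rewrite -[LHS]mulgA -[RHS]mulgA; congr (_ * _)%g.
by apply: commuteX; apply: commute_sym.
Qed.

Lemma expg_two_step (x y : G) n : (forall u v w : G, commute [~ u, v]%g w) ->
  ((x * y) ^+ n = x ^+ n * y ^+ n * [~ y, x] ^+ 'C(n, 2))%g.
Proof.
move=> nil2; move: ([~ y, x]%g) (commgC y x) (nil2 y x) => e yx1 e1.
have ec w k : commute (e ^+ k)%g w by apply: commute_sym; apply: commuteX; exact: commute_sym.
have yx k : (y ^+ k * x = x * y ^+ k * e ^+ k)%g.
  elim: k => [|k IH]; first by rewrite !expg0 mulg1 mul1g mulg1.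
  rewrite expgS -mulgA IH !mulgA yx1 -(mulgA (x * y)%g e) e1.
  by rewrite !mulgA -(mulgA x y) -expgS -(mulgA _ e) -expgS.
elim: n => [|n IH]; first by rewrite bin0n !expg0 !mulg1.
rewrite expgSr IH binS bin1 -!mulgA (ec (x * y)%g) !mulgA.
rewrite -(mulgA _ (y ^+ n)%g x) yx !mulgA -expgSr -!mulgA; congr (_ * _)%g.
rewrite (mulgA (e ^+ n)%g) (ec y) !mulgA -expgSr -!mulgA; congr (_ * _)%g.
by rewrite -expgnDr addnC.
Qed.

Lemma lcoset_mulr (Gam : set G) x g : subgroup Gam -> Gam g -> lcoset Gam (x * g)%g = lcoset
    Gam x.
Proof.
move=> [h1 hd] hg; have hV y : Gam y -> Gam y^-1%g by move=> hy; rewrite -div1g; exact: hd.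
apply/seteqP; split=> _ [y hy <-].
  by exists (g * y)%g; rewrite ?mulgA // -[y]invgK; apply: hd => //; exact: hV.
exists (g^-1 * y)%g; last by rewrite mulgA mulgK.
by rewrite -[y]invgK; apply: hd; exact: hV.
Qed.

Lemma subgroupX (H : set G) x n : subgroup H -> H x -> H (x ^+ n)%g.
Proof.
move=> [h1 hd] hx; have hV y : H y -> H y^-1%g by move=> hy; rewrite -div1g; exact: hd.
by elim: n => // n IH; rewrite expgS -[(x ^+ n)%g]invgK; apply: hd => //; exact: hV.
Qed.

Lemma subgroupM (H : set G) x y : subgroup H -> H x -> H y -> H (x * y)%g.
Proof.
move=> [h1 hd] hx hy; rewrite -[y]invgK; apply: (hd) => //.
by rewrite -div1g; exact: hd.
Qed.

End TwoStepGroup.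

(** * Lattices and fundamental domains in coordinates *)

Section CoordinateLattice.
Variables (R : realType) (m : nat) (c : 'I_m -> 'I_m -> 'I_m -> R).
Implicit Types v w y g : 'rV[R]_m.

(* The subgroup generated by [S] for the law [cmul c], where [- w] is the
   inverse of [w]. *)
Definition cgroup (S : set 'rV[R]_m) : set 'rV[R]_m :=
  [set v | forall H : set 'rV[R]_m, H 0 ->
     (forall v w, H v -> H w -> H (cmul c v (- w))) -> S `<=` H -> H v].

Definition ctail (j : nat) : set 'rV[R]_m :=
  [set v | forall k : 'I_m, (k < j)%N -> v 0 k = 0].

(** Cocompactness for the whole group and, separately, for the tail that carries [F 2], where both
    factors have to remain central. *)
Definition fundamental (S : set 'rV[R]_m) (j : nat) (K : R) : Prop :=
  (forall v, exists y g, [/\ `|y| <= K, cgroup S g & v = cmul c y g]) /\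
  (forall v, ctail j v -> exists y g,
     [/\ `|y| <= K, ctail j y, cgroup S g, ctail j g & v = cmul c y g]).

Lemma fundamental_le S j K K' : K <= K' -> fundamental S j K -> fundamental S j K'.
Proof.
move=> KK [h1 h2]; split => [v|v /h2 [y [g [? ? ? ? ?]]]].
  by have [y [g [? ? ?]]] := h1 v; exists y, g; split => //; exact: le_trans KK.
by exists y, g; split => //; exact: le_trans KK.
Qed.

End CoordinateLattice.

Section NilsequenceCoordinates.
Variables (R : realType) (phi : nilsequence R 2).
Local Notation G := (nil_G phi).
Local Notation B := (nil_B phi).
Local Notation F := (nil_F phi).
Local Notation Gam := (nil_Gam phi).
Local Notation m := (lie_dim G).
Local Notation V := 'rV[R]_m.
Local Notation E := (@lie_exp R G).
Local Notation L := (@lie_log R G).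
Local Notation c := (struct_const B).
Local Notation lcoord := (lcoord B).
Local Notation lpoint := (lpoint B).

Let filt : is_filtration 2 F := @nil_filtration _ _ phi.
Let nil2 : forall x y z : G, commute [~ x, y]%g z := two_step_central filt.
Let malcev : is_malcev_basis B F := @nil_malcev _ _ phi.
Let lM := lcoordM nil2 malcev.

Lemma nil_subgroup : subgroup Gam.
Proof.
have [[F0 _] _ _ _ _] := filt.
by have [h _ _ _] := @nil_lattice _ _ phi 0; move: h; rewrite F0 setIT.
Qed.

Lemma lpointB v w : lpoint (cmul c v (- w)) = (lpoint v / lpoint w)%g.
Proof.
apply: (can_inj (lcoordK malcev)).
by rewrite lM lcoordV !(lpointK malcev).
Qed.

Lemma lpoint0 : lpoint 0 = 1%g.
Proof. by rewrite -(lcoord1 B) (lcoordK malcev). Qed.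

Lemma nil_cgroup (S : set G) g : generates S Gam ->
  Gam g <-> cgroup c (lcoord @` S) (lcoord g).
Proof.
move=> [SG genS]; split => [hg H H0 HB HS|hg].
  apply: (genS [set x | H (lcoord x)]) => //.
    split=> [|x y hx hy] /=; first by rewrite lcoord1.
    by rewrite lM lcoordV; exact: HB.
  by move=> x hx; apply: HS; exists x.
rewrite -[g](lcoordK malcev); have [G1 GB] := nil_subgroup.
apply: (hg [set v | Gam (lpoint v)]) => [|v w hv hw|_ [x hx <-]] /=.
- by rewrite lpoint0.
- by rewrite lpointB; exact: GB.
- by rewrite (lcoordK malcev); exact: SG.
Qed.

Lemma nil_ctail : exists2 j, (j <= m)%N & forall g, F 2%N g <-> ctail j (lcoord g).
Proof.
have [_ _ /(_ 2%N)[j jm F2] _ _] := malcev; exists j => // g; rewrite F2; split.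
  by move=> [X hX <-]; rewrite /lcoord lie_expK.
by move=> h; exists (L g); rewrite ?lie_logK.
Qed.

Lemma compact_lcoord_bounded (K : set V) : compact K ->
  exists k : R, forall X, K X -> `|lcoord (E X)| <= k.
Proof.
move=> /compact_bounded[M [_ hM]].
pose A := invmx B; exists ((M + 1) * \sum_i \sum_j `|A i j|) => X KX.
have XM : `|X| <= M + 1 by apply: hM KX; rewrite ltrDl.
have M0 : 0 <= M + 1 by rewrite (le_trans _ XM).
rewrite /lcoord lie_expK; apply: row_norm_le => [|k].
  by rewrite mulr_ge0 // sumr_ge0 // => i _; rewrite sumr_ge0.
rewrite /bcoord mxE mulr_sumr; apply: (le_trans (ler_norm_sum _ _ _)).
apply: ler_sum => i _; rewrite normrM; apply: ler_pM => //.
  exact: le_trans (row_norm_ge _ _) XM.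
by rewrite (bigD1 k) //= lerDl sumr_ge0.
Qed.

(** This [K] comes from compact sets, with no explicit dependence on the complexity;
    [fundamental_uniform] supplies one. *)
Lemma nil_fundamental (S : set G) j : generates S Gam ->
  (forall g, F 2%N g <-> ctail j (lcoord g)) ->
  exists K, fundamental c (lcoord @` S) j K.
Proof.
move=> genS F2.
have [[F0 _] _ _ _ _] := filt.
have [_ _ _ [K0 [cK0 _ h0]]] := @nil_lattice _ _ phi 0.
have [_ _ _ [K2 [cK2 sK2 h2]]] := @nil_lattice _ _ phi 2.
have [k0 hk0] := compact_lcoord_bounded cK0.
have [k2 hk2] := compact_lcoord_bounded cK2.
exists (Num.max k0 k2); split => [v|v hv].
  have [|X [g [KX [Gg _] e]]] := h0 (lpoint v); first by rewrite F0.
  exists (lcoord (E X)), (lcoord g); split.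
  - by rewrite le_max hk0.
  - exact/nil_cgroup.
  - by rewrite -lM -e (lpointK malcev).
have [|X [g [KX [Gg Fg] e]]] := h2 (lpoint v).
  by apply/F2; rewrite (lpointK malcev).
exists (lcoord (E X)), (lcoord g); split.
- by rewrite le_max hk2 ?orbT.
- by apply/F2; apply: sK2; exists X.
- exact/nil_cgroup.
- exact/F2.
- by rewrite -lM -e (lpointK malcev).
Qed.

(** Split [g0], and [g1] conjugated by [k0], into a bounded factor and a lattice factor. Moving the
    powers of [gam1] to the right leaves central commutators [[~ gam1, k]], which join [z] before
    the product is reduced inside [F 2]. All lattice factors then vanish in the coset. The last term
    is the bracket in the product of [k0] and [k ^+ n]. *)
Lemma nil_normal_form (S : set G) j K : generates S Gam ->
  (forall g, F 2%N g <-> ctail j (lcoord g)) ->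
  fundamental c (lcoord @` S) j K ->
  exists a b v : V, [/\ `|a| <= K, `|b| <= K, `|v| <= K &
    forall n : nat, lcoset Gam (nil_p phi n%:Z) =
      lcoset Gam (lpoint (a + n%:R *: b + 'C(n, 2)%:R *: v + (n%:R / 2) *: cbr c a b))].
Proof.
move=> genS F2 [f1 f2].
have sG := nil_subgroup.
have [_ sF _ _ FR] := filt; have sF2 := sF 2%N.
have red x : exists y g, [/\ `|lcoord y| <= K, Gam g & x = (y * g)%g].
  have [y [g [yK gg e]]] := f1 (lcoord x); exists (lpoint y), (lpoint g).
  rewrite !(lpointK malcev); split=> //.
    by apply/(nil_cgroup _ genS); rewrite (lpointK malcev).
  by apply: (can_inj (lcoordK malcev)); rewrite lM !(lpointK malcev).
have red2 x : F 2%N x -> exists y g, [/\ `|lcoord y| <= K, F 2%N y, Gam g, F 2%N g & x = (y *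
    g)%g].
  move=> /F2 /f2 [y [g [yK ty gg tg e]]]; exists (lpoint y), (lpoint g).
  split; first by rewrite (lpointK malcev).
  - by apply/F2; rewrite (lpointK malcev).
  - by apply/(nil_cgroup _ genS); rewrite (lpointK malcev).
  - by apply/F2; rewrite (lpointK malcev).
  by apply: (can_inj (lcoordK malcev)); rewrite lM !(lpointK malcev).
have cent x z : F 2%N x -> commute x z by exact: (two_step_F2_central filt).
have [g0 [g1 [z [Fz hp]]]] := polynomial_two_step filt (@nil_polynomial _ _ phi).
have [k0 [gam0 [k0K Gg0 e0]]] := red g0.
have [k [gam1 [kK Gg1 e1]]] := red (k0^-1 * g1 * k0)%g.
have [|w [gam2 [wK Fw Gg2 Fg2 e2]]] := red2 (z * [~ gam1, k])%g.
  apply: subgroupM => //; have [[_ F1] _ _ _ _] := filt.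
  by apply: (FR 1%N 1%N); rewrite F1.
exists (lcoord k0), (lcoord k), (lcoord w); split => // n.
have g1n : (g1 ^+ n * k0 = k0 * (k * gam1) ^+ n)%g.
  rewrite -e1; elim: n => [|n IH]; first by rewrite !expg0 mulg1 mul1g.
  by rewrite !expgSr [RHS]mulgA -IH -!mulgA mulVKg.
have -> : nil_p phi n%:Z = (k0 * k ^+ n * w ^+ 'C(n, 2) * (gam1 ^+ n * gam2 ^+ 'C(n, 2) *
    gam0))%g.
  have cz x k1 y : F 2%N x -> commute (x ^+ k1)%g y by move=> hx; apply: cent; exact: subgroupX.
  set N2 := 'C(n, 2).
  have eq2 : (z ^+ N2 * [~ gam1, k] ^+ N2 = w ^+ N2 * gam2 ^+ N2)%g.
    rewrite -expgMn; last by apply: commute_sym; exact: nil2.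
    by rewrite e2 expgMn //; exact: cent.
  rewrite hp e0 -/N2 mulgA -(mulgA _ _ k0) g1n (expg_two_step _ _ _ nil2) -/N2.
  rewrite (cz z N2 _ Fz) -(mulgA k0) -(mulgA (k ^+ n * gam1 ^+ n)%g) -(cz z N2 _ Fz) eq2.
  by rewrite -!mulgA [(gam1 ^+ n * _)%g]mulgA -(cz w N2 _ Fw) -!mulgA.
have lcentral x y : F 2%N x -> cbr c (lcoord y) (lcoord x) = 0.
  move=> Fx; rewrite -(bcoord_br nil2 malcev) lie_br_logE //.
  have /eqP -> : [~ y, x]%g == 1%g by apply/commgP; apply: commute_sym; exact: cent.
  by rewrite lie_log1 /bcoord mul0mx.
rewrite lcoset_mulr //; last first.
  by apply: subgroupM => //; apply: subgroupM => //; exact: subgroupX.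
congr (lcoset _ _); apply: (can_inj (lcoordK malcev)).
rewrite (lpointK malcev) lM lM !lcoordX.
have lc u : cbr c u (lcoord w) = 0 by rewrite -[u](lpointK malcev) lcentral.
rewrite {1}/cmul cbrZr lc !scaler0 addr0 /cmul cbrZr scalerA [2^-1 * _]mulrC.
by rewrite addrAC.
Qed.

End NilsequenceCoordinates.

(** * Covering nilsequences *)

Section FiniteClasses.
Variable R : realType.

(** A numerator shifted by [M] and a denominator. Denominator 0 decodes to 0, so [ratval_le] holds
    for every code. *)
Definition ratcode (M : nat) : finType := ('I_(2 * M).+1 * 'I_M.+1)%type.

Definition ratval (M : nat) (d : ratcode M) : R := (d.1%:R - M%:R) / d.2%:R.

Lemma ratvalP (M : nat) (x : R) : rational_height_le M%:R x -> exists d : ratcode M, ratval d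
    = x.
Proof.
case=> q ->; rewrite ler_nat geq_max => /andP[qn qd].
have h1 : (absz (numq q + M%:Z)%R < (2 * M).+1)%N by lia.
have h2 : (absz (denq q) < M.+1)%N by rewrite ltnS.
exists (Ordinal h1, Ordinal h2); rewrite /ratval /ratr /=.
have -> : (absz (numq q + M%:Z))%:R = (numq q)%:~R + M%:R :> R.
  have : 0 <= numq q + M%:Z by lia.
  by move=> h; rewrite natr_absz ger0_norm // intrD.
by rewrite addrK natr_absz ger0_norm ?denq_ge0.
Qed.

Lemma ratval_le M (d : ratcode M) : `|ratval d| <= M%:R.
Proof.
have hd : `|d.1%:R - M%:R| <= M%:R :> R.
  rewrite ler_norml lerBrDr addNr ler0n /= lerBlDr -natrD ler_nat.
  by rewrite addnn -mul2n -ltnS ltn_ord.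
rewrite /ratval normrM normfV [ `|d.2%:R|]ger0_norm //.
case: (val d.2) => [|n]; first by rewrite invr0 mulr0.
apply: le_trans hd; rewrite ler_piMr // invf_le1 ?ler1n ?ltr0n //.
Qed.

Variables (m M : nat).

Definition structcode : finType := {ffun 'I_m * 'I_m * 'I_m -> ratcode M}.
Definition gencode : finType := {set {ffun 'I_m -> ratcode M}}.

Definition structval (cc : structcode) (i j k : 'I_m) : R := ratval (cc (i, j, k)).
Definition genval (ss : gencode) : set 'rV[R]_m :=
  [set \row_k ratval (s k) | s in [set s | s \in ss]].

Lemma structval_le cc i j k : `|structval cc i j k| <= M%:R.
Proof. exact: ratval_le. Qed.

(* There are finitely many classes of data, each with its own bound. *)
Lemma fundamental_uniform : exists K : nat, (0 < K)%N /\
  forall (cc : structcode) (ss : gencode) (j : nat), (j <= m)%N ->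
  (exists K', fundamental (structval cc) (genval ss) j K') ->
  fundamental (structval cc) (genval ss) j K%:R.
Proof.
pose P (t : structcode * gencode * 'I_m.+1) (K : R) :=
  fundamental (structval t.1.1) (genval t.1.2) t.2 K.
(* Classes without any bound get the dummy value 0. *)
have sel t : exists K, (exists K', P t K') -> P t K.
  by have [[K' h]|h] := pselect (exists K', P t K'); [exists K' | exists 0].
have [f hf] := boolp.choice sel.
exists (Num.bound (\sum_t `|f t|)).+1; split => // cc ss j jm hK.
pose t : structcode * gencode * 'I_m.+1 := (cc, ss, inord j).
have tj : (t.2 : nat) = j by rewrite /t /= inordK.
have := hf t; rewrite /P tj => /(_ hK); apply: fundamental_le.
apply: (@le_trans _ _ (\sum_t `|f t|)).
  apply: (le_trans (ler_norm _)); rewrite (bigD1 t) //= lerDl.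
  by apply: sumr_ge0.
apply: ltW; apply: lt_trans (archi_boundP _) _; first exact: sumr_ge0.
by rewrite ltr_nat.
Qed.

End FiniteClasses.
Arguments genval R {m M} ss.

(** * Rounding to grids *)

Section Grid.
Variable R : realType.

Definition gridpt (K q : nat) (i : 'I_(2 * K * q).+1) : R := i%:R / q%:R - K%:R.

Lemma gridpt_le K q i : (0 < q)%N -> `|@gridpt K q i| <= K%:R.
Proof.
move=> q0; have q0R : 0 < q%:R :> R by rewrite ltr0n.
rewrite /gridpt ler_norml lerBrDr addNr divr_ge0 //= lerBlDr.
rewrite ler_pdivrMr // -natrD -natrM ler_nat addnn -mul2n.
by rewrite -ltnS ltn_ord.
Qed.

Lemma gridptP K q (x : R) : (0 < q)%N -> `|x| <= K%:R -> exists i, `|x - @gridpt K q i| <=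
    q%:R^-1.
Proof.
move=> q0 xK; have q0R : 0 < q%:R :> R by rewrite ltr0n.
have /andP[x1 x2] : - K%:R <= x <= K%:R by rewrite -ler_norml.
have y0 : 0 <= (x + K%:R) * q%:R by rewrite mulr_ge0 // -lerBlDr sub0r.
have /andP[h1 h2] := Num.Theory.truncn_itv y0.
set n := Num.truncn _ in h1 h2.
have nq : (n < (2 * K * q).+1)%N.
  rewrite ltnS -(ler_nat R) (le_trans h1) // natrM natrM ler_pM2r //; lra.
exists (Ordinal nq); rewrite /gridpt /=.
have -> : x - (n%:R / q%:R - K%:R) = ((x + K%:R) * q%:R - n%:R) / q%:R.
  by field; rewrite gt_eqF.
rewrite normrM [ `|q%:R^-1|]ger0_norm ?invr_ge0 // ler_piMl ?invr_ge0 //.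
rewrite ler_norml; move: h2; rewrite -natr1 => h2; lra.
Qed.

Definition gridv (m K q : nat) (f : {ffun 'I_m -> 'I_(2 * K * q).+1}) : 'rV[R]_m :=
  \row_k gridpt (f k).

Lemma gridv_le m K q f : (0 < q)%N -> `|@gridv m K q f| <= K%:R.
Proof. by move=> q0; apply: row_norm_le => // k; rewrite mxE gridpt_le. Qed.

Lemma gridvP m K q (x : 'rV[R]_m) : (0 < q)%N -> `|x| <= K%:R ->
  exists f, `|x - @gridv m K q f| <= q%:R^-1.
Proof.
move=> q0 xK; have h (k : 'I_m) : exists i, `|x 0 k - @gridpt K q i| <= q%:R^-1.
  by apply: gridptP => //; apply: le_trans (row_norm_ge _ _) xK.
have [f hf] := boolp.choice h.
exists (finfun f); apply: row_norm_le => [|k]; first by rewrite invr_ge0.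
by rewrite !mxE ffunE.
Qed.

Definition gridc (K q : nat) (ij : 'I_(2 * K * q).+1 * 'I_(2 * K * q).+1) : R[i] :=
  (gridpt ij.1 +i* gridpt ij.2)%C.

Local Notation normc := ComplexField.Normc.normc.

Lemma normc_le (z : R[i]) : normc z <= `|complex.Re z| + `|complex.Im z|.
Proof.
case: z => a b /=; rewrite -[leRHS]ger0_norm ?addr_ge0 // -sqrtr_sqr ler_wsqrtr //.
rewrite sqrrD !real_normK ?num_real // addrAC lerDl.
by rewrite mulrn_wge0 // mulr_ge0.
Qed.

Lemma normc_ge_Re (z : R[i]) : `|complex.Re z| <= normc z.
Proof.
case: z => a b /=; rewrite -sqrtr_sqr ler_wsqrtr //.
by rewrite lerDl sqr_ge0.
Qed.

Lemma normc_ge_Im (z : R[i]) : `|complex.Im z| <= normc z.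
Proof.
case: z => a b /=; rewrite -sqrtr_sqr ler_wsqrtr //.
by rewrite lerDr sqr_ge0.
Qed.

Lemma gridc_le K q ij : (0 < q)%N -> normc (@gridc K q ij) <= 2 * K%:R.
Proof.
move=> q0; apply: (le_trans (normc_le _)); rewrite mulr2n mulrDl mul1r /=.
by apply: lerD; exact: gridpt_le.
Qed.

Lemma gridcP K q (z : R[i]) : (0 < q)%N -> normc z <= K%:R ->
  exists ij, normc (z - @gridc K q ij) <= 2 / q%:R.
Proof.
move=> q0 zK.
have [i hi] := gridptP q0 (le_trans (normc_ge_Re z) zK).
have [j hj] := gridptP q0 (le_trans (normc_ge_Im z) zK).
exists (i, j); apply: (le_trans (normc_le _)).
rewrite mulr2n mulrDl mul1r; move: hi hj; case: z {zK} => a b /=.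
exact: lerD.
Qed.

End Grid.

Section OrbitPoint.
Variables (R : realType) (m : nat) (c : 'I_m -> 'I_m -> 'I_m -> R).
Implicit Types a b v : 'rV[R]_m.

(* The coordinates of [a b^n v^(n choose 2)] for [v] central. *)
Definition orbit_point a b v (n : nat) : 'rV[R]_m :=
  a + n%:R *: b + 'C(n, 2)%:R *: v + (n%:R / 2) *: cbr c a b.

Variables (M K : R) (N n : nat).
Hypotheses (M0 : 0 <= M) (K0 : 0 <= K) (cM : forall i j k, `|c i j k| <= M).
Hypotheses (N0 : (0 < N)%N) (nN : (n <= N)%N).
Local Notation Lam := ((m * m)%:R * M).

Let N21 : 1 <= N%:R ^+ 2 :> R. Proof. by rewrite -natrX ler1n expn_gt0 N0. Qed.
Let nN2 : n%:R <= N%:R ^+ 2 :> R.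
Proof. by rewrite -natrX ler_nat (leq_trans nN) // expnS expn1 leq_pmulr. Qed.
Let binN2 : 'C(n, 2)%:R <= N%:R ^+ 2 :> R.
Proof.
rewrite -natrX ler_nat bin2.
have hh x : (x./2 <= x)%N by clear; lia.
apply: (leq_trans (hh _)); rewrite expnS expn1; apply: leq_mul => //.
exact: leq_trans (leq_pred _) nN.
Qed.
Let halfN2 : n%:R / 2 <= N%:R ^+ 2 :> R.
Proof. by apply: le_trans nN2; rewrite ler_piMr // invf_le1 // ler1n. Qed.

Let scaled (s : R) x e : 0 <= s -> s <= N%:R ^+ 2 -> `|x : 'rV[R]_m| <= e -> `|s *: x| <=
    N%:R ^+ 2 * e.
Proof. by move=> s0 sN xe; rewrite normrZ ger0_norm // ler_pM. Qed.

Let plain (x : 'rV[R]_m) e : `|x| <= e -> `|x| <= N%:R ^+ 2 * e.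
Proof. by move=> xe; apply: (le_trans xe); rewrite ler_peMl // (le_trans _ xe). Qed.

Let norm4 (x y z w : 'rV[R]_m) e1 e2 e3 e4 : `|x| <= e1 -> `|y| <= e2 -> `|z| <= e3 -> `|w|
    <= e4 ->
  `|x + y + z + w| <= e1 + e2 + e3 + e4.
Proof.
move=> h1 h2 h3 h4; do 3 (apply: (le_trans (ler_normD _ _)); apply: lerD => //).
Qed.

Lemma orbit_point_le a b v : `|a| <= K -> `|b| <= K -> `|v| <= K ->
  `|orbit_point a b v n| <= N%:R ^+ 2 * (3 * K + Lam * K ^+ 2).
Proof.
move=> aK bK vK.
have -> : N%:R ^+ 2 * (3 * K + Lam * K ^+ 2) =
  N%:R ^+ 2 * K + N%:R ^+ 2 * K + N%:R ^+ 2 * K + N%:R ^+ 2 * (Lam * K ^+ 2) by ring.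
apply: norm4; [exact: plain | exact: scaled | exact: scaled | ].
apply: scaled => //.
apply: (le_trans (cbr_norm _ _ M0 cM)).
rewrite -mulrA; apply: ler_wpM2l; first by rewrite mulr_ge0.
by rewrite expr2 ler_pM.
Qed.

Lemma orbit_point_dist a b v a' b' v' e : `|b| <= K -> `|a'| <= K ->
  `|a - a'| <= e -> `|b - b'| <= e -> `|v - v'| <= e ->
  `|orbit_point a b v n - orbit_point a' b' v' n| <= N%:R ^+ 2 * ((3 + 2 * Lam * K) * e).
Proof.
move=> bK aK ae be ve.
have -> : orbit_point a b v n - orbit_point a' b' v' n =
   (a - a') + n%:R *: (b - b') + 'C(n, 2)%:R *: (v - v') + (n%:R / 2) *: (cbr c a b - cbr c
       a' b').
  rewrite /orbit_point; move: (cbr c a b) (cbr c a' b') => A A'.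
  by apply/rowP => k; rewrite !mxE; ring.
have -> : N%:R ^+ 2 * ((3 + 2 * Lam * K) * e) =
  N%:R ^+ 2 * e + N%:R ^+ 2 * e + N%:R ^+ 2 * e + N%:R ^+ 2 * (2 * (Lam * K * e)) by ring.
apply: norm4; [exact: plain | exact: scaled | exact: scaled | ].
apply: scaled => //.
have -> : cbr c a b - cbr c a' b' = cbr c (a - a') b + cbr c a' (b - b').
  by rewrite cbrDl cbrDr cbrNl cbrNr addrA subrK.
have L0 : 0 <= Lam by rewrite mulr_ge0.
rewrite mulr2n mulrDl mul1r; apply: (le_trans (ler_normD _ _)); apply: lerD.
  apply: (le_trans (cbr_norm _ _ M0 cM)); rewrite -!mulrA ler_wpM2l ?ler0n // ler_wpM2l //.
  by rewrite mulrC ler_pM.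
apply: (le_trans (cbr_norm _ _ M0 cM)); rewrite -!mulrA ler_wpM2l ?ler0n // ler_wpM2l //.
by rewrite ler_pM.
Qed.

End OrbitPoint.

(** * Finite codes and the covering theorem *)

Section Codes.
Variables (R : realType) (m M K q Q : nat).

(* Structure constants, generators of the lattice, the parameters [a], [b], [v]
   of the orbit on a grid of mesh [1 / Q], and the values of [psi] on a grid of
   mesh [1 / q], themselves rounded to multiples of [1 / q]. *)
Definition nilcode : finType :=
  (structcode m M * gencode m M *
   ({ffun 'I_m -> 'I_(2 * K * Q).+1} * {ffun 'I_m -> 'I_(2 * K * Q).+1} * {ffun 'I_m -> 'I_(2
       * K * Q).+1}) *
   {ffun {ffun 'I_m -> 'I_(2 * K * q).+1} -> 'I_(2 * M * q).+1 * 'I_(2 * M * q).+1})%type.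

(** The representative is chosen from [c] and [S] alone, so that a code can be evaluated without the
    nilsequence it came from. When [fundamental] holds, the default 0 of [xget] is not reached. *)
Definition reduce (c : 'I_m -> 'I_m -> 'I_m -> R) (S : set 'rV[R]_m) (x : 'rV[R]_m) :
    'rV[R]_m :=
  xget 0 [set y | `|y| <= K%:R /\ exists2 g, cgroup c S g & x = cmul c y g].

Definition roundv (x : 'rV[R]_m) : {ffun 'I_m -> 'I_(2 * K * q).+1} :=
  xget [ffun=> ord0] [set f | `|x - gridv R f| <= q%:R^-1].

Definition nilcode_val (t : nilcode) (n : nat) : R[i] :=
  let: (cc, ss, (fa, fb, fv), tbl) := t in
  let c := structval R cc in
  gridc R (tbl (roundv (reduce c (genval R ss)
    (orbit_point c (gridv R fa) (gridv R fb) (gridv R fv) n)))).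

End Codes.

Section NilCover.
Variables (R : realType) (phi : nilsequence R 2) (M : nat).
Hypothesis cplx : complexity_le phi M%:R.
Local Notation G := (nil_G phi).
Local Notation B := (nil_B phi).
Local Notation F := (nil_F phi).
Local Notation Gam := (nil_Gam phi).
Local Notation m := (lie_dim G).
Local Notation V := 'rV[R]_m.
Local Notation normc := ComplexField.Normc.normc.

Lemma complexity_data : exists (cc : structcode m M) (ss : gencode m M) (j : nat) (S : set G),
  [/\ struct_const B = structval R cc, generates S Gam, lcoord B @` S = genval R ss,
     (j <= m)%N & forall g, F 2%N g <-> ctail j (lcoord B g)].
Proof.
case: cplx => _ hc [S genS hS] _ _.
have [j jm hj] := nil_ctail phi.
have h1 (t : 'I_m * 'I_m * 'I_m) : exists d : ratcode M, ratval R d = struct_const B t.1.1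
    t.1.2 t.2.
  exact: ratvalP.
have [cc hcc] := boolp.choice h1.
pose ss : gencode m M := [set s : {ffun 'I_m -> ratcode M} |
   `[< (lcoord B @` S) (\row_k ratval R (s k)) >] ]%SET.
exists (finfun cc), ss, j, S; split=> //.
  by apply/funext => i; apply/funext => k; apply/funext => l; rewrite /structval ffunE hcc.
apply/seteqP; split=> [v hv|_ [s + <-]]; last by rewrite /= inE => /asboolP.
have h2 (k : 'I_m) : exists d : ratcode M, ratval R d = v 0 k.
  by case: hv => g Sg <-; apply: ratvalP; exact: hS.
have [s hs] := boolp.choice h2.
have vE : \row_k ratval R (finfun s k) = v by apply/rowP => k; rewrite mxE ffunE hs.
by exists (finfun s); rewrite //= inE; apply/asboolP; rewrite vE.
Qed.

Lemma nil_psi_close x y : `|lcoord B (x / y)%g| <= 1 ->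
  normc (nil_psi phi (lcoset Gam x) - nil_psi phi (lcoset Gam y)) <=
  M%:R * malcev_const m M%:R m * `|lcoord B (x / y)%g|.
Proof.
move=> h; case: cplx => _ hc _ hL _.
have filt := @nil_filtration _ _ phi; have nil2 := two_step_central filt.
have [G1 _] := nil_subgroup phi.
apply: (le_trans (hL x y)); rewrite -mulrA ler_wpM2l //.
have cM i j l : `|struct_const B i j l| <= M%:R.
  by have [d <-] := ratvalP (hc i j l); exact: ratval_le.
apply: (coset_dist_le nil2 (@nil_malcev _ _ phi)) => //.
  by exists 1%g; rewrite ?mulg1.
by exists 1%g; rewrite ?mulg1.
Qed.

(** Rounding the parameters to mesh [1 / (q N ^ 4)] moves an orbit point by about [N ^ 2] times the
    mesh, and [lcoord_div_le] costs another [N ^ 2], the size of the point; this leaves [U / q].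
    After reduction modulo the lattice the size is at most [K], so mesh [1 / q] suffices and gives
    [W / q]. The final [2 / q] is the rounding in the table. [U <= q] and [W <= q] keep the
    quotients in the unit ball, as [nil_psi_close] demands. *)
Lemma nil_code_approx (K q N : nat) :
  (forall (cc : structcode m M) (ss : gencode m M) (j : nat), (j <= m)%N ->
    (exists K', fundamental (structval R cc) (genval R ss) j K') ->
    fundamental (structval R cc) (genval R ss) j K%:R) ->
  let Lam : R := (m * m)%:R * M%:R in
  let U := (3 + 2 * Lam * K%:R) * (1 + Lam * (3 * K%:R + Lam * K%:R ^+ 2)) in
  let W := 1 + Lam * K%:R in
  (0 < q)%N -> U <= q%:R -> W <= q%:R -> (0 < N)%N ->
  exists t : nilcode m M K q (q * N ^ 4), forall n, (n <= N)%N ->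
    normc (nil_val phi n%:Z - nilcode_val R t n) <=
      (M%:R * malcev_const m M%:R m * (U + W) + 2) / q%:R.
Proof.
move=> hK Lam U W q0 Uq Wq N0.
have filt := @nil_filtration _ _ phi; have nil2 := two_step_central filt.
have malc := @nil_malcev _ _ phi.
have [cc [ss [j [S [ec genS eS jm F2]]]]] := complexity_data.
have fK : fundamental (struct_const B) (lcoord B @` S) j K%:R.
  by rewrite ec eS; apply: hK => //; rewrite -ec -eS; exact: nil_fundamental.
have cM i k l : `|struct_const B i k l| <= M%:R by rewrite ec structval_le.
have [a [b [v [aK bK vK hp]]]] := nil_normal_form genS F2 fK.
have q0R : 0 < q%:R :> R by rewrite ltr0n.
have N0R : 0 < N%:R :> R by rewrite ltr0n.
have Q0 : (0 < q * N ^ 4)%N by rewrite muln_gt0 q0 expn_gt0 N0.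
have [fa hfa] := gridvP Q0 aK.
have [fb hfb] := gridvP Q0 bK.
have [fv hfv] := gridvP Q0 vK.
have psiM x : normc (nil_psi phi (lcoset Gam x)) <= M%:R by case: cplx => _ _ _ _; exact.
have htbl (f : {ffun 'I_m -> 'I_(2 * K * q).+1}) : exists ij,
    normc (nil_psi phi (lcoset Gam (lpoint B (gridv R f))) - gridc R (K := M) (q := q) ij) <=
        2 / q%:R.
  exact: gridcP.
have [tbl tblP] := boolp.choice htbl.
exists (cc, ss, (fa, fb, fv), finfun tbl) => n nN.
rewrite /nilcode_val ffunE -ec -eS.
set x' := orbit_point _ _ _ _ n.
set x := orbit_point (struct_const B) a b v n.
have Lam0 : 0 <= Lam by rewrite mulr_ge0.
have K0 : 0 <= K%:R :> R by [].
have D0 : 0 <= M%:R * malcev_const m M%:R m :> R.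
  by rewrite mulr_ge0 // (le_trans ler01) // malcev_const_ge1.
have red : exists y, `|y| <= K%:R /\ exists2 g, cgroup (struct_const B) (lcoord B @` S) g
    & x' = cmul (struct_const B) y g.
  by have [y [g [? ? ?]]] := fK.1 x'; exists y; split=> //; exists g.
have [yK [g hg xyg]] : `|reduce K (struct_const B) (lcoord B @` S) x'| <= K%:R /\
   exists2 g, cgroup (struct_const B) (lcoord B @` S) g &
    x' = cmul (struct_const B) (reduce K (struct_const B) (lcoord B @` S) x') g.
  rewrite /reduce; case: xgetP => [y _ //|h].
  by have [y hy] := red; case: (h y hy).
set y := reduce _ _ _ _ in yK xyg *.
have rnd : `|y - gridv R (roundv K q y)| <= q%:R^-1.
  rewrite /roundv; case: xgetP => [f _ //|h].
  by have [f hf] := gridvP q0 yK; case: (h f hf).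
set f := roundv K q y in rnd *.
have step1 : normc (nil_val phi n%:Z - nil_psi phi (lcoset Gam (lpoint B x'))) <=
    M%:R * malcev_const m M%:R m * (U / q%:R).
  rewrite /nil_val hp -/x.
  have hd : `|lcoord B (lpoint B x / lpoint B x')%g| <= U / q%:R.
    apply: (le_trans (lcoord_div_le nil2 malc _ _ (ler0n _ M) cM)).
    rewrite !(lpointK malc).
    have h1 : `|x - x'| <= N%:R ^+ 2 * ((3 + 2 * Lam * K%:R) * (q * N ^ 4)%:R^-1).
      by apply: orbit_point_dist => //; exact: gridv_le.
    have h2 : `|x'| <= N%:R ^+ 2 * (3 * K%:R + Lam * K%:R ^+ 2).
      by apply: orbit_point_le => //; exact: gridv_le.
    have h3 : 1 + Lam * `|x'| <= N%:R ^+ 2 * (1 + Lam * (3 * K%:R + Lam * K%:R ^+ 2)).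
      rewrite mulrDr mulr1; apply: lerD; first by rewrite -natrX ler1n expn_gt0 N0.
      by rewrite mulrCA; apply: ler_wpM2l.
    apply: (le_trans (ler_pM _ _ h1 h3)) => //; first by rewrite addr_ge0 // mulr_ge0.
    rewrite le_eqVlt; apply/orP; left; apply/eqP; rewrite /U natrM natrX.
    by field; rewrite !gt_eqF.
  apply: (le_trans (nil_psi_close _)).
    by apply: (le_trans hd); rewrite ler_pdivrMr // mul1r.
  exact: ler_wpM2l.
have step2 : lcoset Gam (lpoint B x') = lcoset Gam (lpoint B y).
  have -> : lpoint B x' = (lpoint B y * lpoint B g)%g.
    by apply: (can_inj (lcoordK malc)); rewrite (lcoordM nil2 malc) !(lpointK malc).
  apply: lcoset_mulr; first exact: nil_subgroup.
  by apply/(nil_cgroup _ genS); rewrite (lpointK malc).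
have step3 : normc (nil_psi phi (lcoset Gam (lpoint B y)) -
    nil_psi phi (lcoset Gam (lpoint B (gridv R f)))) <=
    M%:R * malcev_const m M%:R m * (W / q%:R).
  have hd : `|lcoord B (lpoint B y / lpoint B (gridv R f))%g| <= W / q%:R.
    apply: (le_trans (lcoord_div_le nil2 malc _ _ (ler0n _ M) cM)).
    rewrite !(lpointK malc) [leRHS]mulrC; apply: ler_pM => //.
    by rewrite lerD2l ler_wpM2l // gridv_le.
  apply: (le_trans (nil_psi_close _)).
    by apply: (le_trans hd); rewrite ler_pdivrMr // mul1r.
  exact: ler_wpM2l.
have -> : (M%:R * malcev_const m M%:R m * (U + W) + 2) / q%:R =
   M%:R * malcev_const m M%:R m * (U / q%:R) + M%:R * malcev_const m M%:R m * (W / q%:R) + 2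
       / q%:R :> R.
  by field; rewrite gt_eqF.
have tri (z1 z2 z3 z4 : R[i]) : normc (z1 - z4) <= normc (z1 - z2) + normc (z2 - z3) + normc
    (z3 - z4).
  have -> : z1 - z4 = (z1 - z2) + (z2 - z3) + (z3 - z4) by ring.
  by apply: (le_trans (le_normcD _ _)); rewrite lerD2r; exact: le_normcD.
apply: (le_trans (tri _ _ _ _)); apply: lerD; last exact: (tblP f).
by apply: lerD; [exact: step1 | rewrite step2; exact: step3].
Qed.

End NilCover.

Section CodeCount.

(** Only the three orbit parameters depend on [N]: each has [m] coordinates on a grid refined
    [N ^ 4] times. *)
Lemma card_nilcode (m M K q N : nat) : (0 < N)%N ->
  (#|nilcode m M K q (q * N ^ 4)| <= #|nilcode m M K q q| * N ^ (12 * m))%N.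
Proof.
move=> N0; rewrite !card_prod !card_ffun !card_ord.
have h : ((2 * K * (q * N ^ 4)).+1 ^ m <= (2 * K * q).+1 ^ m * N ^ (4 * m))%N.
  have mono x y k : (x <= y -> x ^ k <= y ^ k)%N.
    by move=> xy; elim: k => // k IH; rewrite !expnS leq_mul.
  rewrite expnM -expnMn; apply: mono.
  by rewrite mulnA -addn1 -[(2 * K * q).+1]addn1 mulnDl mul1n leq_add2l expn_gt0 N0.
have -> : (N ^ (12 * m) = N ^ (4 * m) * N ^ (4 * m) * N ^ (4 * m))%N.
  by rewrite -!expnD; congr (_ ^ _)%N; clear; lia.
move: h.
move: ((2 * K * (q * N ^ 4)).+1 ^ m)%N => a; move: ((2 * K * q).+1 ^ m)%N => b; move: (N ^ (4
    * m))%N => w h.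
rewrite [leqRHS]mulnAC; apply: leq_mul => //.  rewrite -[leqRHS]mulnA.  apply: leq_mul => //.
by rewrite (mulnACA (b * b)%N) (mulnACA b b); apply: leq_mul => //; exact: leq_mul.
Qed.

End CodeCount.

Section Cover.
Variable R : realType.
Local Notation normc := ComplexField.Normc.normc.

Lemma complexity_leW (s : nat) (phi : nilsequence R s) (C C' : R) : C <= C' ->
  complexity_le phi C -> complexity_le phi C'.
Proof.
move=> CC [h1 h2 [S genS hS] h4 h5].
have hh x : rational_height_le C x -> rational_height_le C' x.
  by case=> r -> hr; exists r => //; exact: le_trans CC.
split.
- exact: le_trans CC.
- by move=> i j k; exact: hh.
- by exists S => // g k Sg; apply: hh; exact: hS.
- move=> x y; apply: (le_trans (h4 x y)); apply: ler_wpM2r => //.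
  exact: coset_dist_ge0.
- by move=> x; apply: le_trans CC.
Qed.

Theorem nil_cover (C eps : R) : 0 < eps -> exists (F : R) (A D : nat),
  forall N, (0 < N)%N -> exists (T : finType) (f : T -> nat -> R[i]),
    [/\ (#|T| <= A * N ^ D)%N, forall t n, normc (f t n) <= F &
     forall phi : nilsequence R 2, complexity_le phi C ->
       exists t, forall n, (n <= N)%N -> normc (nil_val phi n%:Z - f t n) <= eps].
Proof.
move=> eps0; pose M := (Num.bound `|C|).
have CM : C <= M%:R.
  by apply: (le_trans (ler_norm C)); apply: ltW; exact: archi_boundP.
(* For each dimension, first a size [K] of fundamental domains, then a mesh [1 / q] fine enough for
   it; neither depends on [N]. *)
have hparam (m : nat) : exists Kq : nat * nat,
    (forall (cc : structcode m M) (ss : gencode m M) (j : nat), (j <= m)%N ->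
      (exists K', fundamental (structval R cc) (genval R ss) j K') ->
      fundamental (structval R cc) (genval R ss) j Kq.1%:R) /\
    let Lam : R := (m * m)%:R * M%:R in
    let U := (3 + 2 * Lam * Kq.1%:R) * (1 + Lam * (3 * Kq.1%:R + Lam * Kq.1%:R ^+ 2)) in
    let W := 1 + Lam * Kq.1%:R in
    [/\ (0 < Kq.2)%N, U <= Kq.2%:R, W <= Kq.2%:R &
      (M%:R * malcev_const m M%:R m * (U + W) + 2) / Kq.2%:R <= eps].
  have [K [K0 hK]] := fundamental_uniform R m M.
  pose Lam : R := (m * m)%:R * M%:R.
  pose U := (3 + 2 * Lam * K%:R) * (1 + Lam * (3 * K%:R + Lam * K%:R ^+ 2)).
  pose W := 1 + Lam * K%:R.
  pose X := (M%:R * malcev_const m M%:R m * (U + W) + 2) / eps.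
  pose q := (Num.bound (`|U| + `|W| + `|X|)).+1.
  have qX : `|U| + `|W| + `|X| <= q%:R.
    apply: ltW; apply: lt_trans (archi_boundP _) _; first by rewrite !addr_ge0.
    by rewrite ltr_nat.
  exists (K, q); split => //= ; split => //.
  - apply: le_trans qX; apply: (le_trans (ler_norm U)); rewrite -addrA lerDl addr_ge0 //.
  - apply: le_trans qX; apply: (le_trans (ler_norm W)); rewrite addrAC lerDr addr_ge0 //.
  - rewrite ler_pdivrMr ?ltr0n // [leRHS]mulrC -ler_pdivrMr //.
    by apply: le_trans qX; apply: (le_trans (ler_norm X)); rewrite lerDr addr_ge0.
have [P hP] := boolp.choice hparam.
exists (2 * M%:R), (\sum_(m < M.+1) #|nilcode m M (P m).1 (P m).2 (P m).2|)%N, (12 * M)%N.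
move=> N N0.
(* The complexity bounds the dimension by [M], so the codes of all dimensions up to [M] are put
   together. *)
pose T (m : 'I_M.+1) : finType := nilcode m M (P m).1 (P m).2 ((P m).2 * N ^ 4).
exists {m : 'I_M.+1 & T m}, (fun t => nilcode_val R (tagged t)); split.
- rewrite card_tagged sumnE big_map big_enum /= big_distrl /=; apply: leq_sum => m _.
  apply: (leq_trans (card_nilcode _ _ _ _ N0)); rewrite leq_mul2l; apply/orP; right.
  by rewrite leq_pexp2l // leq_mul2l -ltnS ltn_ord orbT.
- move=> [m [[[cc ss] [[fa fb] fv]] tbl]] n; apply: gridc_le.
  by have [_ []] := hP m.
- move=> phi /(complexity_leW CM) hphi.
  have mM : (lie_dim (nil_G phi) < M.+1)%N by case: hphi => + _ _ _ _; rewrite ler_nat ltnS.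
  have [hK [q0 Uq Wq err]] := hP (lie_dim (nil_G phi)).
  have [t ht] := nil_code_approx hphi hK q0 Uq Wq N0.
  exists (@Tagged _ (Ordinal mM) T t) => n nN.
  exact: le_trans (ht n nN) err.
Qed.

End Cover.

(** * Random subsets *)

Section RandomSubset.
Variable R : realType.

(** From [expR (- x) >= 1 - x], since [(1 - x) * (1 + x + 2 * x ^+ 2) = 1 + x ^+ 2 * (1 - 2 *
    x)]. *)
Lemma expR_le_quadratic (x : R) : x <= 2^-1 -> expR x <= 1 + x + 2 * x ^+ 2.
Proof.
move=> x2; have h : 1 - x <= expR (- x) by exact: expR_ge1Dx.
have x1 : 0 < 1 - x by lra.
have e0 := expR_gt0 x; have e1 := expRxMexpNx_1 x.
rewrite -(ler_pM2r x1); apply: (@le_trans _ _ 1).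
  by rewrite -[leRHS]e1 ler_pM2l.
have : 0 <= x ^+ 2 * (1 - 2 * x) by rewrite mulr_ge0 ?sqr_ge0 //; lra.
rewrite !expr2; lra.
Qed.

(** Centering removes the first-order term. The factor [p] in the exponent matters: a bound by the
    range of the variable alone would be far too weak for densities near [kappa / d]. *)
Lemma bernoulli_mgf (p u : R) : 0 <= p <= 1 -> `|u| <= 2^-1 ->
  p * expR (u * (1 - p)) + (1 - p) * expR (u * (0 - p)) <= expR (2 * (p * u ^+ 2)).
Proof.
move=> /andP[p0 p1]; rewrite ler_norml => /andP[u1 u2].
have h1 : expR (u * (1 - p)) <= 1 + u * (1 - p) + 2 * (u * (1 - p)) ^+ 2.
  by apply: expR_le_quadratic; nra.
have h2 : expR (u * (0 - p)) <= 1 + u * (0 - p) + 2 * (u * (0 - p)) ^+ 2.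
  by apply: expR_le_quadratic; nra.
have h3 : 1 + 2 * (p * u ^+ 2) <= expR (2 * (p * u ^+ 2)) by exact: expR_ge1Dx.
apply: le_trans h3.
apply: (@le_trans _ _ (p * (1 + u * (1 - p) + 2 * (u * (1 - p)) ^+ 2) +
   (1 - p) * (1 + u * (0 - p) + 2 * (u * (0 - p)) ^+ 2))).
  by apply: lerD; apply: ler_wpM2l => //; rewrite subr_ge0.
have : 0 <= 2 * (p * u) ^+ 2 by rewrite mulr_ge0 // sqr_ge0.
rewrite !expr2; lra.
Qed.

Variables (mu : nat -> R) (N : nat).
Hypothesis mu01 : forall d, (0 < d)%N -> 0 <= mu d <= 1.

Definition subset_weight (S : {set 'I_N}) : R :=
  \prod_(i < N) (if i \in S then mu i.+1 else 1 - mu i.+1).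

Definition centered_sum (S : {set 'I_N}) (a : nat -> R) : R :=
  \sum_(i < N) a i.+1 * ((i \in S)%:R - mu i.+1).

Lemma subset_weight_ge0 S : 0 <= subset_weight S.
Proof.
apply: prodr_ge0 => i _; have /andP[h1 h2] := mu01 (ltn0Sn i).
by case: ifP => _ //; rewrite subr_ge0.
Qed.

(** Independence: the expectation of a product over the coordinates factorizes. *)
Lemma subset_weight_sum (F G : 'I_N -> R) :
  \sum_(S : {set 'I_N}) subset_weight S * \prod_(i < N) (if i \in S then F i else G i) =
  \prod_(i < N) (mu i.+1 * F i + (1 - mu i.+1) * G i).
Proof.
rewrite (bigA_distr _ _ (fun i : 'I_N => mu i.+1 * F i) (fun i : 'I_N => (1 - mu i.+1) * G i)).
apply: eq_bigr => S _; rewrite -big_split; apply: eq_bigr => i _ /=.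
by case: ifP.
Qed.

Lemma subset_weight_total : \sum_(S : {set 'I_N}) subset_weight S = 1.
Proof.
have := subset_weight_sum (fun=> 1) (fun=> 1).
rewrite [X in _ = X -> _]big1 => [<-|i _]; last by rewrite !mulr1 addrC subrK.
by apply: eq_bigr => S _; rewrite big1 ?mulr1 // => i _; case: ifP.
Qed.

Lemma random_subset_probC (E : set {set 'I_N}) :
  1 - random_subset_prob mu E = \sum_(S | ~~ `[< E S >]) subset_weight S.
Proof.
rewrite -subset_weight_total (bigID (fun S => `[< E S >])) /= /random_subset_prob
    /subset_weight.
by rewrite addrAC subrr add0r.
Qed.

Lemma chernoff (a : nat -> R) (lam s : R) : 0 <= lam ->
  (forall i : 'I_N, lam * `|a i.+1| <= 2^-1) ->
  \sum_(S | s <= centered_sum S a) subset_weight S <=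
  expR (- (lam * s) + 2 * (lam ^+ 2 * \sum_(i < N) mu i.+1 * a i.+1 ^+ 2)).
Proof.
move=> lam0 la.
apply: (@le_trans _ _ (\sum_(S : {set 'I_N}) subset_weight S * expR (lam * (centered_sum S a
    - s)))).
  rewrite big_mkcond; apply: ler_sum => S _; have w0 := subset_weight_ge0 S.
  case: ifP => h; last by rewrite mulr_ge0 // expR_ge0.
  rewrite ler_peMr // (le_trans _ (expR_ge1Dx _)) // lerDl mulr_ge0 // subr_ge0 //.
have -> : \sum_(S : {set 'I_N}) subset_weight S * expR (lam * (centered_sum S a - s)) =
   expR (- (lam * s)) * \sum_(S : {set 'I_N}) subset_weight S *
     \prod_(i < N) (if i \in S then expR (lam * a i.+1 * (1 - mu i.+1)) else expR (lam * a
         i.+1 * (0 - mu i.+1))).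
  rewrite mulr_sumr; apply: eq_bigr => S _; rewrite mulrCA; congr (_ * _).
  rewrite mulrBr addrC expRD; congr (_ * _).
  rewrite /centered_sum mulr_sumr expR_sum; apply: eq_bigr => i _.
  by rewrite mulrA; case: ifP.
rewrite expRD ler_pM2l ?expR_gt0 // subset_weight_sum.
have -> : 2 * (lam ^+ 2 * \sum_(i < N) mu i.+1 * a i.+1 ^+ 2) =
   \sum_(i < N) 2 * (mu i.+1 * (lam * a i.+1) ^+ 2).
  by rewrite !mulr_sumr; apply: eq_bigr => i _; ring.
rewrite expR_sum; apply: ler_prod => i _; have /andP[h1 h2] := mu01 (ltn0Sn i).
apply/andP; split.
  by apply: addr_ge0; apply: mulr_ge0; rewrite ?expR_ge0 // subr_ge0.
by apply: bernoulli_mgf; rewrite ?h1 // normrM ger0_norm.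
Qed.

Lemma chernoff_norm (a : nat -> R) (lam s : R) : 0 <= lam ->
  (forall i : 'I_N, lam * `|a i.+1| <= 2^-1) ->
  \sum_(S | s <= `|centered_sum S a|) subset_weight S <=
  2 * expR (- (lam * s) + 2 * (lam ^+ 2 * \sum_(i < N) mu i.+1 * a i.+1 ^+ 2)).
Proof.
move=> lam0 la; have h1 := chernoff s lam0 la.
have la' (i : 'I_N) : lam * `|- a i.+1| <= 2^-1 by rewrite normrN.
have := @chernoff (fun i => - a i) lam s lam0 la'.
under [X in _ <= expR (_ + _ * (_ * X))]eq_bigr do rewrite sqrrN.
move=> h2; rewrite mulr2n mulrDl mul1r; apply: le_trans (lerD h1 h2).
rewrite big_mkcond [X in _ <= X + _]big_mkcond [X in _ <= _ + X]big_mkcond -big_split.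
apply: ler_sum => S _ /=.
have -> : centered_sum S (fun i => - a i) = - centered_sum S a.
  by rewrite /centered_sum -sumrN; apply: eq_bigr => i _; rewrite mulNr.
have w0 := subset_weight_ge0 S.
rewrite ler_normr; case: (s <= _); case: (s <= _) => /=; rewrite ?addr0 ?add0r //.
by rewrite lerDl.
Qed.

End RandomSubset.

(** * Progressions with harmonic weights *)

Section HarmonicSum.
Variable R : realType.

Definition hweight (d0 d : nat) : R := if (d0 <= d)%N then d%:R^-1 else 0.

Definition hsum (d0 N : nat) : R := \sum_(i < N) hweight d0 i.+1.

Lemma hweight_ge0 d0 d : 0 <= hweight d0 d.
Proof. by rewrite /hweight; case: ifP => // _; rewrite invr_ge0. Qed.

Lemma hsum_ge0 d0 N : 0 <= hsum d0 N.
Proof. by apply: sumr_ge0 => i _; exact: hweight_ge0. Qed.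

(** Multiply [expR (1 / n) >= (n + 1) / n] over [d0 <= n <= N]; below [d0] the left side is at most
    1. *)
Lemma expR_hsum d0 N : (0 < d0)%N -> N.+1%:R / d0%:R <= expR (hsum d0 N).
Proof.
move=> d00; have d0R : 0 < d0%:R :> R by rewrite ltr0n.
elim: N => [|N IH].
  by rewrite /hsum big_ord0 expR0 ler_pdivrMr // mul1r ler1n.
have [h|h] := leqP d0 N.+1.
  rewrite /hsum big_ord_recr /= -/(hsum d0 N) expRD.
  have -> : N.+2%:R / d0%:R = N.+1%:R / d0%:R * (N.+2%:R / N.+1%:R) :> R.
    by rewrite [RHS]mulrC mulrA divfK ?pnatr_eq0.
  apply: ler_pM => //; rewrite ?divr_ge0 //.
  rewrite /hweight h; apply: le_trans (expR_ge1Dx _).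
  by rewrite -[N.+2%:R]natr1 mulrDl mulfV ?pnatr_eq0 // div1r.
apply: (@le_trans _ _ 1); first by rewrite ler_pdivrMr // mul1r ler_nat.
by rewrite -expR0 ler_expR hsum_ge0.
Qed.

(** At most [N <= k * (Q + 1)] terms are dropped, each at most [1 / (Q + 1)]. *)
Lemma hsum_div d0 N k : (0 < k)%N -> hsum d0 N - k%:R <= hsum d0 (N %/ k).
Proof.
move=> k0; set Q := (N %/ k)%N; have QN : (Q <= N)%N by exact: leq_div.
have NQ : (N <= k * Q.+1)%N by rewrite mulnC ltnW // ltn_ceil.
have -> : N = (Q + (N - Q))%N by rewrite subnKC.
rewrite /hsum big_split_ord /= -addrA gerDl subr_le0.
apply: (@le_trans _ _ (\sum_(i < N - Q) Q.+1%:R^-1)).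
  apply: ler_sum => i _; rewrite /hweight; case: ifP => _; last by rewrite invr_ge0.
  by rewrite lef_pV2 ?posrE ?ltr0n // ler_nat ltnS leq_addr.
rewrite sumr_const card_ord -[leLHS]mulr_natl ler_pdivrMr ?ltr0n // -natrM ler_nat.
exact: leq_trans (leq_subr _ _) NQ.
Qed.

Lemma sum_multiples_le (g : nat -> R) j Q N : (forall d, 0 <= g d) -> (0 < j)%N ->
  (j * Q <= N)%N -> \sum_(i < Q) g (j * i.+1)%N <= \sum_(i < N) g i.+1.
Proof.
move=> g0 j0 jQ.
have mono a b : (a <= b)%N -> \sum_(i < a) g i.+1 <= \sum_(i < b) g i.+1.
  move=> /subnKC <-; rewrite big_split_ord /= lerDl.
  by apply: sumr_ge0.
apply: le_trans (mono _ _ jQ) => {N jQ}.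
elim: Q => [|Q IH]; first by rewrite muln0 !big_ord0.
rewrite big_ord_recr mulnSr big_split_ord /=; apply: lerD => //.
case: j j0 {IH mono} => // j _.
rewrite big_ord_recr /= -[X in X <= _]add0r; apply: lerD; first exact: sumr_ge0.
by rewrite addnS.
Qed.

Lemma cnt_elt N (A : {set 'I_N}) : cnt (elt A) N.+1 = #|A|.
Proof.
rewrite /cnt big_ord_recl.
have -> : elt A (ord0 : 'I_N.+1) = false by apply/existsP => -[a /andP[_]].
rewrite add0n -sum1_card [RHS]big_mkcond; apply: eq_bigr => i _ /=.
have -> : elt A i.+1 = (i \in A).
  apply/existsP/idP => [[a /andP[aA]]|iA]; last by exists i; rewrite iA /= eqxx.
  by rewrite eqSS => /eqP/val_inj <-.
by case: (i \in A).
Qed.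

Lemma elt_le N (A : {set 'I_N}) y : elt A y -> (0 < y <= N)%N.
Proof. by move=> /existsP[a /andP[_ /eqP <-]]; rewrite ltn_ord. Qed.

Definition ap_at N (A : {set 'I_N}) (d y : nat) : bool :=
  [&& elt A y, elt A (y + d) & elt A (y + 2 * d)].

Lemma ap_countE N (A : {set 'I_N}) d :
  ap_count R A d = (cnt (ap_at A d) N.+1)%:R / N%:R.
Proof.
rewrite /ap_count mulrC; congr (_ / _).
rewrite big_add1 /= big_mkord /cnt natr_sum big_ord_recl /=.
have -> : ap_at A d 0 = false.
  by apply/negP => /andP[/elt_le].
rewrite add0r; apply: eq_bigr => i _; rewrite /ap_at.
by case: (elt _ _); case: (elt _ _); case: (elt _ _); rewrite ?mulr1 ?mulr0 ?mul0r.
Qed.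

Lemma ap_count_ge0 N (A : {set 'I_N}) d : 0 <= ap_count R A d.
Proof. by rewrite ap_countE divr_ge0. Qed.

(* Roth's theorem on the progressions [x, x + q, ..., x + (L - 1) q], averaged
   over [x]. *)
Lemma roth_dilate (delta : R) : 0 < delta -> exists L : nat, (0 < L)%N /\
  forall N (A : {set 'I_N}) q, (4 <= N)%N -> (0 < q)%N -> 4 * (L * q)%:R <= delta * N%:R ->
  delta * N%:R <= #|A|%:R ->
  delta / (8 * L%:R) <= \sum_(1 <= j < L) ap_count R A (j * q).
Proof.
move=> delta0; have [|L [L0 hL]] := @roth R (delta / 2); first by rewrite divr_gt0.
exists L; split=> // N A q N4 q0 hq hA.
have LR : 0 < L%:R :> R by rewrite ltr0n.
have NR : 0 < N%:R :> R by rewrite ltr0n; exact: leq_trans N4.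
pose W x := cnt (fun i => elt A (x + i * q)) L.
pose good x := delta / 2 * L%:R <= (W x)%:R.
have hgood x : good x -> (0 < \sum_(1 <= j < L) \sum_(i < L) ap_at A (j * q) (x + i * q))%N.
  move=> gx; pose A' i := elt A (x + i * q)%N && (i < L)%N.
  have : ~ ap3_free A'.
    move=> fr; have := hL _ fr; apply/negP; rewrite -leNgt; apply: le_trans gx _.
    by rewrite ler_nat; apply: leq_cnt => i iL hi; rewrite /A' hi.
  apply: contra_notT; rewrite -leqNgt leqn0 => /eqP h0 y d d0 /andP[h1 yL] /andP[h2 _]
      /andP[h3 y2L].
  have dL : (1 <= d < L)%N by rewrite d0 /= (leq_ltn_trans _ y2L) // mul2n -addnn addnCA
      leq_addr.
  move: h0; rewrite (bigD1_seq d) ?mem_index_iota ?iota_uniq //=.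
  rewrite (bigD1 (Ordinal yL)) //=.
  have -> : ap_at A (d * q) (x + y * q)%N.
    rewrite /ap_at h1 /=; apply/andP; split.
      by move: h2; rewrite mulnDl addnA.
    by move: h3; rewrite mulnDl addnA mulnA.
  by [].
have upper : (\sum_(x < N.+1) good x <= \sum_(1 <= j < L) L * cnt (ap_at A (j * q)) N.+1)%N.
  apply: (@leq_trans (\sum_(x < N.+1) \sum_(1 <= j < L) \sum_(i < L) ap_at A (j * q) (x + i *
      q))).
    by apply: leq_sum => x _; case: (boolP (good x)) => // /hgood.
  rewrite exchange_big /=; apply: leq_sum => j _; rewrite exchange_big /=.
  rewrite -[X in (_ <= X * _)%N]card_ord -sum_nat_const; apply: leq_sum => i _.
  have -> : (\sum_(x < N.+1) ap_at A (j * q) (x + i * q) =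
             cnt (fun x => ap_at A (j * q) (i * q + x)) N.+1)%N.
    by apply: eq_bigr => x _; rewrite addnC.
  apply: (@leq_trans (cnt (ap_at A (j * q)) (i * q + N.+1))); first by rewrite cntD leq_addl.
  rewrite addnC cntD [X in (_ + X)%N]big1 ?addn0 // => z _.
  apply/eqP; rewrite eqb0; apply/negP => /andP[/elt_le/andP[_]].
  by rewrite addSn ltnNge leq_addr.
(* Of [delta * N], at most a quarter is lost at the ends of the windows, and windows that are not
   good account for at most [delta * (N + 1) / 2], which is at most five eighths as [4 <= N]. An
   eighth remains. *)
have lower : delta * N%:R / 8 <= (\sum_(x < N.+1) good x)%:R.
  have hw := cnt_window (elt A) L q N.+1; rewrite cnt_elt in hw.
  have h1 : (\sum_(y < N.+1) W y)%:R <= L%:R * (\sum_(x < N.+1) good x)%:R + N.+1%:R * (delta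
      / 2 * L%:R).
    rewrite !natr_sum mulr_sumr -[X in _ + X%:R * _]card_ord [X in _ + X]mulr_natl
        -sumr_const -big_split /=.
    apply: ler_sum => x _; case: (boolP (good x)) => gx.
      rewrite mulr1 ler_wpDr //; last by rewrite ler_nat cnt_le.
      by rewrite mulr_ge0 // divr_ge0 // ltW.
    by rewrite mulr0 add0r ltW // ltNge.
  have h2 : L%:R * #|A|%:R <= (\sum_(y < N.+1) W y)%:R + L%:R * (L * q)%:R :> R.
    by rewrite -!natrM -natrD ler_nat.
  have h3 : L%:R * (delta * N%:R) <= L%:R * #|A|%:R by rewrite ler_pM2l.
  rewrite -(ler_pM2l LR).
  have N4R : 4 <= N%:R :> R by rewrite (ler_nat _ 4).
  have h4 : L%:R * (4 * (L * q)%:R) <= L%:R * (delta * N%:R) by rewrite ler_pM2l.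
  have h5 : L%:R * (delta * 4) <= L%:R * (delta * N%:R) by rewrite ler_pM2l // ler_pM2l.
  by move: h1 h2 h3 h4 h5; rewrite -natr1; clear; lra.
have : delta * N%:R / 8 <= L%:R * (N%:R * \sum_(1 <= j < L) ap_count R A (j * q)).
  apply: (le_trans lower); apply: (@le_trans _ _ (\sum_(1 <= j < L) L * cnt (ap_at A (j * q))
      N.+1)%:R).
    by rewrite ler_nat.
  rewrite natr_sum !mulr_sumr; apply: ler_sum => j _.
  by rewrite ap_countE natrM [N%:R * _]mulrC divfK // gt_eqF.
rewrite [delta * _]mulrC -mulrA [L%:R * (_ * _)]mulrCA ler_pM2l // => h.
by rewrite invfM mulrA ler_pdivrMr // [leRHS]mulrC.
Qed.

(** Apply [roth_dilate] with weight [1 / q] for each [q <= N / k]. A difference [d = j * q]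
    satisfies [1 / q = j / d <= L / d] and arises for fewer than [L] values of [j], whence the loss
    [L * L]. *)
Lemma harmonic_roth (delta : R) : 0 < delta -> exists (c : R) (k : nat), 0 < c /\
  forall N d0 (A : {set 'I_N}), (4 <= N)%N -> delta * N%:R <= #|A|%:R ->
  c * (hsum d0 N - k%:R) <= \sum_(i < N) hweight d0 i.+1 * ap_count R A i.+1.
Proof.
move=> delta0; have [L [L0 hL]] := roth_dilate delta0.
have LR : 0 < L%:R :> R by rewrite ltr0n.
(* Ensures [L * q <= N] and [4 * L * q <= delta * N] for all [q <= N / k]. *)
pose k := maxn L (Num.bound (4 * L%:R / delta)).
have kL : (L <= k)%N by rewrite leq_maxl.
have k0 : (0 < k)%N by exact: leq_trans kL.
have kd : 4 * L%:R <= delta * k%:R.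
  rewrite [leRHS]mulrC -ler_pdivrMr //; apply: ltW.
  apply: lt_le_trans (archi_boundP _) _; first by rewrite divr_ge0 ?mulr_ge0 // ltW.
  by rewrite ler_nat leq_maxr.
pose c2 := delta / (8 * L%:R).
have c20 : 0 < c2 by rewrite divr_gt0 // mulr_gt0.
exists (c2 / (L%:R * L%:R)), k; split; first by rewrite divr_gt0 // mulr_gt0.
move=> N d0 A N4 hA.
pose g d := hweight d0 d * ap_count R A d.
have g0 d : 0 <= g d by rewrite mulr_ge0 ?hweight_ge0 ?ap_count_ge0.
pose Q := (N %/ k)%N.
have Qk : (Q * k <= N)%N by exact: leq_trunc_div.
have main : c2 * hsum d0 Q <= L%:R * L%:R * \sum_(i < N) g i.+1.
  apply: (@le_trans _ _ (\sum_(i < Q) hweight d0 i.+1 * \sum_(1 <= j < L) ap_count R A (j *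
      i.+1))).
    rewrite mulrC mulr_suml; apply: ler_sum => i _; apply: ler_wpM2l; first exact: hweight_ge0.
    apply: hL => //.
    rewrite natrM mulrA; apply: (@le_trans _ _ (delta * k%:R * i.+1%:R)); first exact:
        ler_wpM2r.
    rewrite -mulrA -natrM ler_pM2l // ler_nat (leq_trans _ Qk) // mulnC leq_mul2r.
    by rewrite ltn_ord orbT.
  apply: (@le_trans _ _ (\sum_(1 <= j < L) L%:R * \sum_(i < Q) g (j * i.+1)%N)).
    under eq_bigr do rewrite mulr_sumr.
    rewrite exchange_big /= big_nat [leRHS]big_nat; apply: ler_sum => j /andP[j1 jL].
    rewrite mulr_sumr; apply: ler_sum => i _; rewrite /g mulrA.
    apply: ler_wpM2r; first exact: ap_count_ge0.
    rewrite /hweight; case: ifP => [h|_]; last first.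
      by rewrite mulr_ge0 //; case: ifP => // _; rewrite invr_ge0.
    have -> : (d0 <= j * i.+1)%N by rewrite (leq_trans h) // leq_pmull.
    rewrite natrM invfM mulrA ler_peMl ?invr_ge0 // ler_pdivlMr ?ltr0n // mul1r ler_nat.
    exact: ltnW.
  apply: (@le_trans _ _ (\sum_(1 <= j < L) L%:R * \sum_(i < N) g i.+1)).
    rewrite big_nat [leRHS]big_nat; apply: ler_sum => j /andP[j1 jL].
    apply: ler_wpM2l => //; apply: sum_multiples_le => //.
    by apply: leq_trans Qk; rewrite mulnC leq_mul2l (leq_trans (ltnW jL)) ?orbT.
  rewrite sumr_const_nat -[leLHS]mulr_natl mulrA; apply: ler_wpM2r; first exact: sumr_ge0.
  by rewrite -!natrM ler_nat leq_mul2r leq_subr orbT.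
rewrite mulrAC ler_pdivrMr ?mulr_gt0 // [leRHS]mulrC; apply: le_trans main.
by rewrite ler_pM2l // hsum_div.
Qed.

End HarmonicSum.

(** * The random differences *)

Section WeightedDeviation.
Variables (R : realType) (mu : nat -> R) (kappa : R) (d0 : nat).
Hypothesis mu01 : forall d, (0 < d)%N -> 0 <= mu d <= 1.
Hypotheses (kappa0 : 0 < kappa) (d00 : (0 < d0)%N).
Hypothesis mu_large : forall d, (d0 <= d)%N -> kappa <= d%:R * mu d.
Local Notation normc := ComplexField.Normc.normc.

(* Weighting [d] by [thin d] replaces the density [mu d] by [kappa / d]. *)
Definition thin (d : nat) : R := if (d0 <= d)%N then kappa / (d%:R * mu d) else 0.

Lemma thin_mu d : mu d * thin d = kappa * hweight R d0 d.
Proof.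
rewrite /thin /hweight; case: ifP => h; last by rewrite !mulr0.
have := lt_le_trans kappa0 (mu_large h) => p.
have md : mu d != 0 by apply: contraTneq p => ->; rewrite mulr0 ltxx.
by rewrite invfM mulrCA [_^-1 * _]mulrC [mu d * _]mulrA mulfV // mul1r.
Qed.

Lemma thin_ge0 d : 0 <= thin d.
Proof.
rewrite /thin; case: ifP => h //; have := lt_le_trans kappa0 (mu_large h) => p.
by rewrite divr_ge0 // ltW.
Qed.

Lemma thin_le1 d : thin d <= 1.
Proof.
rewrite /thin; case: ifP => h //; have := lt_le_trans kappa0 (mu_large h) => p.
by rewrite ler_pdivrMr // mul1r mu_large.
Qed.

Variable N : nat.
Local Notation H := (hsum R d0 N).
Implicit Type S : {set 'I_N}.

Lemma thin_mu_sum : \sum_(i < N) mu i.+1 * thin i.+1 = kappa * H.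
Proof. by rewrite mulr_sumr; apply: eq_bigr => i _; rewrite thin_mu. Qed.

Definition thin_centered S (g : nat -> R) : R := centered_sum mu S (fun d => thin d * g d).

Lemma thin_deviation (g : nat -> R) (F eta : R) : 1 <= F -> 0 < eta <= 1 ->
  (forall d, `|g d| <= F) ->
  \sum_(S | eta * (kappa * H) <= `|thin_centered S g|) subset_weight mu S <=
  2 * expR (- (eta ^+ 2 / (8 * F ^+ 2) * kappa * H)).
Proof.
move=> F1 /andP[eta0 eta1] gF.
have F0 : 0 < F by exact: lt_le_trans F1.
have F2 : F != 0 by rewrite gt_eqF.
(* Minimizes [- lam * eta + 2 * lam ^+ 2 * F ^+ 2], the Chernoff exponent per unit of
   [kappa * H]. *)
pose lam := eta / (4 * F ^+ 2).
have lam0 : 0 <= lam by rewrite divr_ge0 ?mulr_ge0 ?exprn_ge0 // ltW.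
have lamF : lam * F <= 2^-1.
  have -> : lam * F = eta / 4 / F by rewrite /lam; field.
  by rewrite ler_pdivrMr //; lra.
have aF d : `|thin d * g d| <= F.
  rewrite normrM ger0_norm ?thin_ge0 // -[leRHS]mul1r.
  by apply: ler_pM => //; [exact: thin_ge0 | exact: thin_le1].
have h (i : 'I_N) : lam * `|thin i.+1 * g i.+1| <= 2^-1.
  by apply: le_trans lamF; apply: ler_wpM2l.
apply: (le_trans (chernoff_norm mu01 _ lam0 h)); rewrite ler_pM2l // ler_expR.
(* As [thin] is at most 1, its square is at most [thin], and the variance is governed by
   [thin_mu_sum]. *)
have hs : \sum_(i < N) mu i.+1 * (thin i.+1 * g i.+1) ^+ 2 <= F ^+ 2 * (kappa * H).
  rewrite -thin_mu_sum mulr_sumr; apply: ler_sum => i _.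
  have /andP[m0 m1] := mu01 (ltn0Sn i).
  rewrite [leRHS]mulrCA; apply: ler_wpM2l => //; rewrite exprMn [leLHS]mulrC; apply: ler_pM;
      rewrite ?sqr_ge0 //.
    by rewrite -real_normK ?num_real // lerXn2r ?nnegrE // ltW.
  by rewrite expr2 ler_piMr ?thin_ge0 ?thin_le1.
have : lam ^+ 2 * \sum_(i < N) mu i.+1 * (thin i.+1 * g i.+1) ^+ 2 <= lam ^+ 2 * (F ^+ 2 *
    (kappa * H)).
  by apply: ler_wpM2l => //; exact: sqr_ge0.
have -> : lam ^+ 2 * (F ^+ 2 * (kappa * H)) = eta ^+ 2 / (16 * F ^+ 2) * kappa * H.
  by rewrite /lam; field.
have -> : lam * (eta * (kappa * H)) = 2 * (eta ^+ 2 / (8 * F ^+ 2) * kappa * H).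
  by rewrite /lam; field.
have -> : eta ^+ 2 / (8 * F ^+ 2) * kappa * H = 2 * (eta ^+ 2 / (16 * F ^+ 2) * kappa * H) by
    field.
lra.
Qed.

Definition thin_ccentered S (f : nat -> R[i]) : R[i] :=
  \sum_(i < N) (thin i.+1 * ((i \in S)%:R - mu i.+1))%:C%C * f i.+1.

Lemma normc_real (x : R) : normc (x%:C)%C = `|x|.
Proof. by rewrite /= expr0n /= addr0 sqrtr_sqr. Qed.

Lemma Re_sum (I : Type) (r : seq I) (f : I -> R[i]) :
  complex.Re (\sum_(i <- r) f i) = \sum_(i <- r) complex.Re (f i).
Proof. by apply: (big_morph (fun z => complex.Re z)) => // -[a b] [c d]. Qed.

Lemma Im_sum (I : Type) (r : seq I) (f : I -> R[i]) :
  complex.Im (\sum_(i <- r) f i) = \sum_(i <- r) complex.Im (f i).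
Proof. by apply: (big_morph (fun z => complex.Im z)) => // -[a b] [c d]. Qed.

Lemma normc_sum (I : Type) (r : seq I) (f : I -> R[i]) :
  normc (\sum_(i <- r) f i) <= \sum_(i <- r) normc (f i).
Proof.
elim: r => [|i r IH]; first by rewrite !big_nil normc_real normr0.
by rewrite !big_cons; apply: (le_trans (le_normcD _ _)); rewrite lerD2l.
Qed.

Lemma thin_ccentered_Re S f :
  complex.Re (thin_ccentered S f) = thin_centered S (fun d => complex.Re (f d)).
Proof.
rewrite Re_sum; apply: eq_bigr => i _; case: (f i.+1) => a b /=.
by rewrite mul0r subr0; ring.
Qed.

Lemma thin_ccentered_Im S f :
  complex.Im (thin_ccentered S f) = thin_centered S (fun d => complex.Im (f d)).
Proof.
rewrite Im_sum; apply: eq_bigr => i _; case: (f i.+1) => a b /=.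
by rewrite mul0r addr0; ring.
Qed.

(** Such an [f] contributes at most [e] times the weighted mass of [S] plus the mean of that mass.
    The deviation of the constant 1 controls the mass, which is why this function joins the union
    bound. *)
Lemma thin_ccentered_small S f e t : 0 <= e ->
  `|thin_centered S (fun=> 1)| <= t ->
  (forall d, (1 <= d <= N)%N -> normc (f d) <= e) ->
  normc (thin_ccentered S f) <= e * (t + 2 * (kappa * H)).
Proof.
move=> e0 ht fe; apply: (le_trans (normc_sum _ _)).
have T0 (i : 'I_N) : 0 <= thin i.+1 * ((i \in S)%:R + mu i.+1).
  by have /andP[m0 _] := mu01 (ltn0Sn i); rewrite mulr_ge0 ?thin_ge0 // addr_ge0.
apply: (@le_trans _ _ (e * \sum_(i < N) thin i.+1 * ((i \in S)%:R + mu i.+1))).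
  rewrite mulr_sumr; apply: ler_sum => i _; rewrite ComplexField.Normc.normcM normc_real
      [leRHS]mulrC.
  apply: ler_pM; rewrite ?normr_ge0 //; first exact: (le_trans _ (normc_ge_Re _)).
    rewrite normrM ger0_norm ?thin_ge0 //; apply: ler_wpM2l; first exact: thin_ge0.
    have /andP[m0 _] := mu01 (ltn0Sn i).
    by apply: (le_trans (ler_normB _ _)); rewrite !ger0_norm.
  by apply: fe; rewrite ltn_ord.
apply: ler_wpM2l => //.
have -> : \sum_(i < N) thin i.+1 * ((i \in S)%:R + mu i.+1) =
  thin_centered S (fun=> 1) + 2 * (kappa * H).
  rewrite -thin_mu_sum mulr_sumr -big_split; apply: eq_bigr => i _ /=; ring.
by rewrite lerD2r; apply: le_trans ht; exact: ler_norm.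
Qed.

Lemma thin_ccenteredD S f g :
  thin_ccentered S (fun d => f d + g d) = thin_ccentered S f + thin_ccentered S g.
Proof. by rewrite -big_split; apply: eq_bigr => i _; rewrite mulrDr. Qed.

Lemma thin_ccentered_comb S k (c : 'I_k -> R[i]) (f : 'I_k -> nat -> R[i]) :
  thin_ccentered S (fun d => \sum_j c j * f j d) = \sum_j c j * thin_ccentered S (f j).
Proof.
under eq_bigr do rewrite mulr_sumr.
rewrite exchange_big; apply: eq_bigr => j _ /=; rewrite mulr_sumr.
by apply: eq_bigr => i _; rewrite mulrCA.
Qed.

Lemma eq_thin_ccentered S f g : (forall d, (1 <= d <= N)%N -> f d = g d) ->
  thin_ccentered S f = thin_ccentered S g.
Proof. by move=> fg; apply: eq_bigr => i _; rewrite fg // ltn_ord. Qed.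

(** In units of [eta * kappa * H], each [phi j] deviates by at most 5: 2 for the real and imaginary
    parts of its approximant, 3 for the approximation error. The error [e] costs another 3. The
    total 8 stays below the mean, at least [kappa * gam], so some [d] in [S] has a positive
    count. *)
Lemma small_deviation_AP S (A : {set 'I_N}) (T : Type) (f : T -> nat -> R[i])
    (k : nat) (phi : 'I_k -> nat -> R[i]) (c : 'I_k -> R[i]) (e : nat -> R[i]) (eta gam : R) :
  0 < eta <= 1 -> 8 * (eta * H) < gam ->
  `|thin_centered S (fun=> 1)| <= eta * (kappa * H) ->
  (forall t, `|thin_centered S (fun d => complex.Re (f t d))| <= eta * (kappa * H)) ->
  (forall t, `|thin_centered S (fun d => complex.Im (f t d))| <= eta * (kappa * H)) ->
  (forall j, exists t, forall d, (d <= N)%N -> normc (phi j d - f t d) <= eta) ->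
  \sum_j normc (c j) <= 1 ->
  (forall d, (1 <= d <= N)%N -> normc (e d) <= eta) ->
  (forall d, (1 <= d <= N)%N -> (ap_count R A d)%:C%C = \sum_j c j * phi j d + e d) ->
  gam <= \sum_(i < N) hweight R d0 i.+1 * ap_count R A i.+1 ->
  exists x d : nat, [/\ elt S d, elt A x, elt A (x + d) & elt A (x + 2 * d)].
Proof.
move=> /andP[eta0 eta1] hgam d1 dR dI approx c1 he hap hA.
have H0 : 0 <= H by exact: hsum_ge0.
set M := kappa * H in d1 dR dI *.
have M0 : 0 <= M by rewrite mulr_ge0 // ltW.
have small g : (forall d, (1 <= d <= N)%N -> normc (g d) <= eta) -> normc (thin_ccentered S
    g) <= 3 * (eta * M).
  move=> hg; apply: (le_trans (thin_ccentered_small (ltW eta0) d1 hg)).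
  have : eta * (eta * M) <= 1 * (eta * M) by rewrite ler_wpM2r // mulr_ge0 // ltW.
  by rewrite -/M; lra.
have hphi j : normc (thin_ccentered S (phi j)) <= 5 * (eta * M).
  have [t ht] := approx j.
  have -> : thin_ccentered S (phi j) = thin_ccentered S (f t) + thin_ccentered S (fun d =>
      phi j d - f t d).
    by rewrite -thin_ccenteredD; apply: eq_thin_ccentered => d _; rewrite addrC subrK.
  have h1 : normc (thin_ccentered S (f t)) <= 2 * (eta * M).
    apply: (le_trans (normc_le _)); rewrite thin_ccentered_Re thin_ccentered_Im.
    by rewrite mulr2n mulrDl mul1r; apply: lerD.
  have h2 : normc (thin_ccentered S (fun d => phi j d - f t d)) <= 3 * (eta * M).
    by apply: small => d /andP[_]; exact: ht.
  by apply: (le_trans (le_normcD _ _)); lra.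
have htot : normc (thin_ccentered S (fun d => (ap_count R A d)%:C%C)) <= 8 * (eta * M).
  rewrite (eq_thin_ccentered _ hap) thin_ccenteredD thin_ccentered_comb.
  apply: (le_trans (le_normcD _ _)).
  have h1 : normc (\sum_j c j * thin_ccentered S (phi j)) <= 5 * (eta * M).
    apply: (le_trans (normc_sum _ _)).
    apply: (@le_trans _ _ (\sum_j normc (c j) * (5 * (eta * M)))).
      apply: ler_sum => j _; rewrite ComplexField.Normc.normcM; apply: ler_wpM2l => //.
      exact: (le_trans _ (normc_ge_Re _)).
    rewrite -mulr_suml -[leRHS]mul1r; apply: ler_wpM2r => //.
    by rewrite !mulr_ge0 // ltW.
  by have := small e he; lra.
have hRe : thin_centered S (ap_count R A) >= - (8 * (eta * M)).
  have := le_trans (normc_ge_Re _) htot; rewrite thin_ccentered_Re /=.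
  by rewrite ler_norml => /andP[].
have split : thin_centered S (ap_count R A) =
   \sum_(i < N) thin i.+1 * (i \in S)%:R * ap_count R A i.+1 -
   kappa * \sum_(i < N) hweight R d0 i.+1 * ap_count R A i.+1.
  rewrite mulr_sumr -sumrB; apply: eq_bigr => i _.
  by rewrite mulrA -thin_mu; ring.
have pos : 0 < \sum_(i < N) thin i.+1 * (i \in S)%:R * ap_count R A i.+1.
  have h1 : kappa * gam <= kappa * \sum_(i < N) hweight R d0 i.+1 * ap_count R A i.+1.
    by rewrite ler_pM2l.
  have h2 : kappa * (8 * (eta * H)) < kappa * gam by rewrite ltr_pM2l.
  by move: hRe; rewrite split /M; lra.
have [i iS ai] : exists2 i : 'I_N, i \in S & 0 < ap_count R A i.+1.
  apply: contrapT => hn; move: pos; rewrite big1 ?ltxx // => i _.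
  have [iS|] := boolP (i \in S); last by rewrite mulr0 mul0r.
  have [a0|a0] := leP (ap_count R A i.+1) 0; last by exfalso; apply: hn; exists i.
  have -> : ap_count R A i.+1 = 0 by apply: le_anti; rewrite a0 ap_count_ge0.
  by rewrite mulr0.
have : cnt (ap_at A i.+1) N.+1 != 0%N.
  by apply: contraTneq ai => h0; rewrite ap_countE h0 mul0r ltxx.
rewrite /cnt sum_nat_eq0 negb_forall => /existsP[x] /=; rewrite eqb0 negbK => /and3P[h1 h2 h3].
exists x, i.+1; split => //; apply/existsP; exists i; by rewrite iS eqxx.
Qed.

End WeightedDeviation.

Lemma hsum_unbounded (R : realType) d0 (x : R) : (0 < d0)%N ->
  exists N0, forall N, (N0 <= N)%N -> x <= hsum R d0 N.
Proof.
move=> d00; exists (d0 * Num.bound (expR x))%N => N hN.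
rewrite -ler_expR; apply: le_trans (expR_hsum R N d00).
rewrite ler_pdivlMr ?ltr0n //; apply: (@le_trans _ _ ((Num.bound (expR x))%:R * d0%:R)).
  by rewrite ler_pM2r ?ltr0n // ltW // archi_boundP // expR_ge0.
by rewrite -natrM mulnC ler_nat (leq_trans hN).
Qed.

Lemma failure_prob_bound (R : realType) (mu : nat -> R) (delta : R) :
  nilsequence_approximation R ->
  (forall d : nat, (0 < d)%N -> 0 <= mu d <= 1) ->
  (d%:R * mu d @[d --> \oo] --> +oo) -> 0 < delta ->
  exists (C : R) (N0 : nat), forall N, (N0 <= N)%N ->
    `|1 - random_subset_prob mu (dense_sets_have_AP delta (N := N))| <= C / N%:R ^+ 101.
Proof.
move=> hP mu01 hmu delta0.
have [c [k [c0 hroth]]] := harmonic_roth delta0.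
(* The deviation [8 * eta * H] is at most [c * H / 4], below the bound of [harmonic_roth] once
   [H >= 2 * k + 1]. *)
pose eta := Num.min 1 (c / 32).
have eta0 : 0 < eta by rewrite lt_min ltr01 divr_gt0.
have eta1 : 0 < eta <= 1 by rewrite eta0 ge_min lexx.
have etac : eta <= c / 32 by rewrite ge_min lexx orbT.
have [C hC] := hP eta eta0.
have [F0 [A [D hcover]]] := nil_cover C eta0.
pose F := 1 + `|F0|.
have F1 : 1 <= F by rewrite lerDl.
have F0F : F0 <= F by apply: (le_trans (ler_norm _)); rewrite lerDr.
(* The union bound costs [N ^ D], and 101 leaves one power of [N] to spare. Then [kappa] solves
   [eta ^+ 2 / (8 * F ^+ 2) * kappa = r], where the left side is the rate in [thin_deviation]. *)
pose r := (D + 101)%N.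
pose kappa := 8 * F ^+ 2 / eta ^+ 2 * r%:R.
have Fpos : 0 < F by exact: lt_le_trans F1.
have kappa0 : 0 < kappa.
  by rewrite !mulr_gt0 ?invr_gt0 ?exprn_gt0 // ltr0n /r addnS.
have [d0 d00 mu_large] : exists2 d0, (0 < d0)%N & forall d, (d0 <= d)%N -> kappa <= d%:R * mu d.
  have /cvgryPge/(_ kappa)[d1 _ hd1] := hmu.
  by exists d1.+1 => // d hd; apply: hd1; exact: ltnW.
have [N1 hN1] := hsum_unbounded (2 * k%:R + 1 : R) d00.
exists (2 * (2 * A + 1)%:R * d0%:R ^+ r), (maxn 4 N1) => N; rewrite geq_max => /andP[N4 NN1].
have N0 : (0 < N)%N by exact: leq_trans N4.
have NR : 0 < N%:R :> R by rewrite ltr0n.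
have Hbig := hN1 N NN1; set H := hsum R d0 N in Hbig.
have H0 : 0 < H by apply: lt_le_trans Hbig; rewrite ltr_wpDl // mulr_ge0.
have [T [f [cardT fF hT]]] := hcover N N0.
have [n [phi [hphi hA]]] := hC N N0.
rewrite random_subset_probC ger0_norm; last first.
  by apply: sumr_ge0 => S _; exact: subset_weight_ge0.
pose g (u : T + T + unit) (d : nat) : R := match u with
  | inl (inl t) => complex.Re (f t d)
  | inl (inr t) => complex.Im (f t d)
  | inr _ => 1 end.
have gF u d : `|g u d| <= F.
  case: u => [[t|t]|_] /=; last by rewrite normr1.
    by apply: (le_trans (normc_ge_Re _)); apply: (le_trans (fF t d)).
  by apply: (le_trans (normc_ge_Im _)); apply: (le_trans (fF t d)).
pose bad u (S : {set 'I_N}) := eta * (kappa * H) <= `|thin_centered mu kappa d0 S (g u)|.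
have hbad (S : {set 'I_N}) : ~~ `[< dense_sets_have_AP delta S >] -> [exists u, bad u S].
  apply: contraR; rewrite negb_exists => /forallP hgood; apply/asboolP => X hX.
  have good u : `|thin_centered mu kappa d0 S (g u)| <= eta * (kappa * H).
    by apply: ltW; rewrite ltNge; exact: hgood.
  have [cc [e [c1 he hap]]] := hA X.
  have hr := hroth N d0 X N4 hX; rewrite -/H in hr.
  have hgam : 8 * (eta * H) < c * (H - k%:R).
    have h1 : eta * H <= c / 32 * H by rewrite ler_wpM2r // ltW.
    have h2 : c * (2 * k%:R + 1) <= c * H by rewrite ler_pM2l.
    have h3 : 0 <= c * k%:R by rewrite mulr_ge0 // ltW.
    by move: h1 h2 h3 c0; clear; lra.
  apply: (@small_deviation_AP _ mu kappa d0 mu01 kappa0 mu_large N S X T f n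
    (fun j d => nil_val (phi j) d%:Z) cc e eta (c * (H - k%:R))) => //.
  - exact: (good (inr tt)).
  - by move=> t; exact: (good (inl (inl t))).
  - by move=> t; exact: (good (inl (inr t))).
  - by move=> j; exact: hT.
apply: (@le_trans _ _ (\sum_(u : T + T + unit) \sum_(S | bad u S) subset_weight mu S)).
  under [leRHS]eq_bigr do rewrite big_mkcond.
  rewrite exchange_big big_mkcond; apply: ler_sum => S _ /=.
  have w0 := subset_weight_ge0 mu01 S.
  have s0 : 0 <= \sum_u (if bad u S then subset_weight mu S else 0).
    by apply: sumr_ge0 => u _; case: ifP.
  case: ifP => // /hbad /existsP[u hu].
  rewrite (bigD1 u) //= hu lerDl; apply: sumr_ge0 => v _; by case: ifP.
apply: (@le_trans _ _ (\sum_(u : T + T + unit) 2 * expR (- (r%:R * H)))).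
  apply: ler_sum => u _.
  have := @thin_deviation _ mu kappa d0 mu01 kappa0 mu_large N (g u) F eta F1 eta1 (gF u).
  suff -> : eta ^+ 2 / (8 * F ^+ 2) * kappa * hsum R d0 N = r%:R * H by [].
  by rewrite /kappa -/H; field; rewrite !gt_eqF.
rewrite sumr_const -[leLHS]mulr_natl.
have cardU : (#|{: T + T + unit}| <= (2 * A + 1) * N ^ D)%N.
  rewrite !card_sum card_unit addnn -mul2n mulnDl mul1n -mulnA leq_add ?leq_mul2l //.
  by rewrite expn_gt0 N0.
(* [expR_hsum] turns the harmonic mass back into a power of [N]. *)
have hexp : expR (- (r%:R * H)) <= (d0%:R / N%:R) ^+ r.
  rewrite expRN expRM_natl -exprVn lerXn2r ?nnegrE ?invr_ge0 ?expR_ge0 ?divr_ge0 //.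
  rewrite -[leRHS]invf_div lef_pV2 ?posrE ?expR_gt0 ?divr_gt0 ?ltr0n //.
  apply: le_trans (expR_hsum R N d00); rewrite ler_pM2r ?invr_gt0 ?ltr0n //.
  by rewrite ler_nat.
apply: (@le_trans _ _ (((2 * A + 1) * N ^ D)%:R * (2 * (d0%:R / N%:R) ^+ r))).
  apply: ler_pM => //; rewrite ?mulr_ge0 ?expR_ge0 ?ler_nat //.
  by rewrite ler_pM2l.
rewrite natrM natrX expr_div_n /r [N%:R ^+ (D + 101)]exprD.
rewrite le_eqVlt; apply/orP; left; apply/eqP; field.
by rewrite !expf_neq0 // gt_eqF.
Qed.

Theorem theorem2p5 (R : realType)
  (hP : nilsequence_approximation R)
  (mu : nat -> R)
  (hmu01 : forall d : nat, (0 < d)%N -> 0 <= mu d <= 1)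
  (hmu : d%:R * mu d @[d --> \oo] --> +oo)
  (delta : R) (hdelta : 0 < delta) :
  (fun N : nat =>
     1 - random_subset_prob mu (dense_sets_have_AP delta (N := N)) : R)
    =o_\oo (fun N : nat => N%:R ^- 100 : R).
Proof.
have [C [N0 hC]] := failure_prob_bound hP hmu01 hmu hdelta.
apply/eqoP => eps eps0.
pose N1 := Num.bound (`|C| / eps).
exists (maxn N0 N1.+1) => // N /=; rewrite geq_max => /andP[NN0 NN1].
have NR : 0 < N%:R :> R by rewrite ltr0n; exact: leq_trans NN1.
apply: (le_trans (hC N NN0)); rewrite [ `|N%:R ^- 100|]ger0_norm ?invr_ge0 ?exprn_ge0 //.
rewrite exprS invfM mulrA ler_pM2r ?invr_gt0 ?exprn_gt0 //.
rewrite ler_pdivrMr //; apply: (le_trans (ler_norm _)).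
rewrite mulrC -ler_pdivrMr //; apply: ltW; apply: lt_trans (archi_boundP _) _.
  by rewrite divr_ge0 // ltW.
by rewrite ltr_nat.
Qed.
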